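(* Let $G$ be a channel metric satisfying axioms (M), (E), (Ap) and (N). Then for every channel $\Phi$ and tangent vector $\Delta$ at $\Phi$, \[ G^{\min,p}_\Phi(\Delta)\le G_\Phi(\Delta)\le G^{\max,p}_\Phi(\Delta). \] Moreover, $G^{\min,p}$ and $G^{\max,p}$ are channel metrics satisfying (M), (E), (Ap) and (N).
   Context: All Hilbert spaces are finite-dimensional. A channel is a CPTP linear map; probability distributions on finite sets are identified with diagonal states, and a quantum state with the channel from $\mathbb C$ outputting it. A tangent vector $\Delta$ at a channel $\Phi$ is a Hermiticity-preserving linear map with $\mathrm{tr}\,\Delta(X)=0$ for all $X$. $J_p(\delta)=\sum_y\delta(y)^2/p(y)$ for a probability distribution $p$ on a finite set and real $\delta$ with $\sum_y\delta(y)=0$ ($0/0=0$, $c/0=\infty$ for $c\ne0$). A channel metric $G$ assigns to each channel $\Phi$ and tangent $\Delta$ at $\Phi$ a value $G_\Phi(\Delta)\in[0,\infty]$ with $G_\Phi(t\Delta)=t^2G_\Phi(\Delta)$. Axioms: (M) $G_\Phi(\Delta)\ge G_{\Phi\circ\Psi}(\Delta\circ\Psi)$ and $G_\Phi(\Delta)\ge G_{\Psi\circ\Phi}(\Psi\circ\Delta)$ for all channels $\Psi$ with compositions defined; (E) $G_{\Phi\otimes\mathbf I}(\Delta\otimes\mathbf I)=G_\Phi(\Delta)$ for the identity channel on any auxiliary system; (N) $G_p(\delta)=J_p(\delta)$ for probability distributions $p$ on finite sets and tangents $\delta$ at $p$; (Ap) $\lim_{n\to\infty}\frac1nG_{\Phi^{\otimes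 n}}(\Delta^{(n)})=G_\Phi(\Delta)$ for all $\Phi,\Delta$, where $\Delta^{(n)}:=\sum_{k=1}^n\Phi^{\otimes(k-1)}\otimes\Delta\otimes\Phi^{\otimes(n-k)}$ (the tangent vector at $\Phi^{\otimes n}$). $G^{\min}_\Phi(\Delta):=\sup J_{M((\Phi\otimes\mathbf I)(\rho))}\big(M((\Delta\otimes\mathbf I)(\rho))\big)$ over auxiliary spaces $\mathcal K$, states $\rho$ on $\mathcal H_{\rm in}\otimes\mathcal K$ and POVMs $M$ on $\mathcal H_{\rm out}\otimes\mathcal K$ (a POVM being identified with the channel $\sigma\mapsto(\mathrm{tr}\,\sigma M_y)_y$). A classical tangent simulation of $(\Phi,\Delta)$ is $(q,\delta,\Lambda)$ with $q$ a probability distribution on a finite set $Y$, $\delta$ real on $Y$ with $\sum\delta=0$, $\Lambda$ a channel from $\mathcal H_{\rm in}\otimes\mathbb C^Y$ to $\mathcal H_{\rm out}$ with $\Phi(X)=\Lambda(X\otimes q)$, $\Delta(X)=\Lambda(X\otimes\delta)$ for all $X$; $G^{\max}_\Phi(\Delta):=\inf J_q(\delta)$ over such simulations. Finally $G^{\min,p}_\Phi(\Delta):=\lim_{n\to\infty}\frac1nG^{\min}_{\Phi^{\otimes n}}(\Delta^{(n)})$ and $G^{\max,p}_\Phi(\Delta):=\lim_{n\to\infty}\frac1nG^{\max}_{\Phi^{\otimes n}}(\Delta^{(n)})$. *)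

(* Defs.v *)
From Stdlib Require Import Reals Lra ClassicalEpsilon FunctionalExtensionality.
From HB Require Import structures.
From mathcomp Require Import all_boot all_order all_algebra.

Set Implicit Arguments.
Unset Strict Implicit.
Unset Printing Implicit Defensive.

Notation rzero := (IZR Z0).
Notation rone := (IZR (Zpos xH)).

Record cpx := Cpx { Re : R; Im : R }.

Definition cpx_eqb (a b : cpx) : bool :=
  (if Req_EM_T (Re a) (Re b) then true else false) &&
  (if Req_EM_T (Im a) (Im b) then true else false).

Lemma cpx_eqP : Equality.axiom cpx_eqb.
Proof.
move=> [a1 a2] [b1 b2]; rewrite /cpx_eqb /=.
case: (Req_EM_T a1 b1) => h1; case: (Req_EM_T a2 b2) => h2 /=;
  constructor; try (by subst); by case.
Qed.

HB.instance Definition _ := hasDecEq.Build cpx cpx_eqP.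

Definition cpx_find (P : pred cpx) (n : nat) : option cpx :=
  match excluded_middle_informative (exists x, P x) with
  | left h => Some (proj1_sig (constructive_indefinite_description _ h))
  | right _ => None
  end.

Lemma cpx_find_correct P n x : cpx_find P n = Some x -> P x.
Proof.
rewrite /cpx_find; case: excluded_middle_informative => // h [<-].
exact: proj2_sig (constructive_indefinite_description _ h).
Qed.

Lemma cpx_find_complete (P : pred cpx) : (exists x, P x) -> exists n, cpx_find P n.
Proof.
move=> h; exists 0%N; rewrite /cpx_find; case: excluded_middle_informative => //.
Qed.

Lemma cpx_find_ext (P Q : pred cpx) : P =1 Q -> cpx_find P =1 cpx_find Q.
Proof.
move=> hPQ; have -> : P = Q by apply: functional_extensionality.
by [].
Qed.

HB.instance Definition _ :=
  hasChoice.Build cpx cpx_find_correct cpx_find_complete cpx_find_ext.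

Definition cpx0 := Cpx rzero rzero.
Definition cpx1 := Cpx rone rzero.
Definition cpx_add (a b : cpx) := Cpx (Rplus (Re a) (Re b)) (Rplus (Im a) (Im b)).
Definition cpx_opp (a : cpx) := Cpx (Ropp (Re a)) (Ropp (Im a)).
Definition cpx_mul (a b : cpx) :=
  Cpx (Rminus (Rmult (Re a) (Re b)) (Rmult (Im a) (Im b)))
      (Rplus (Rmult (Re a) (Im b)) (Rmult (Im a) (Re b))).
Definition cpx_conj (a : cpx) := Cpx (Re a) (Ropp (Im a)).

Lemma cpx_addA : associative cpx_add.
Proof. move=> [??] [??] [??]; rewrite /cpx_add /=; f_equal; ring. Qed.
Lemma cpx_addC : commutative cpx_add.
Proof. move=> [??] [??]; rewrite /cpx_add /=; f_equal; ring. Qed.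
Lemma cpx_add0 : left_id cpx0 cpx_add.
Proof. move=> [??]; rewrite /cpx_add /=; f_equal; ring. Qed.
Lemma cpx_addN : left_inverse cpx0 cpx_opp cpx_add.
Proof. move=> [??]; rewrite /cpx_add /cpx0 /=; f_equal; ring. Qed.

HB.instance Definition _ :=
  GRing.isZmodule.Build cpx cpx_addA cpx_addC cpx_add0 cpx_addN.

Lemma cpx_mulA : associative cpx_mul.
Proof. move=> [??] [??] [??]; rewrite /cpx_mul /=; f_equal; ring. Qed.
Lemma cpx_mulC : commutative cpx_mul.
Proof. move=> [??] [??]; rewrite /cpx_mul /=; f_equal; ring. Qed.
Lemma cpx_mul1 : left_id cpx1 cpx_mul.
Proof. move=> [??]; rewrite /cpx_mul /cpx1 /=; f_equal; ring. Qed.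
Lemma cpx_mulDl : left_distributive cpx_mul cpx_add.
Proof. move=> [??] [??] [??]; rewrite /cpx_mul /cpx_add /=; f_equal; ring. Qed.
Lemma cpx_one_neq0 : cpx1 != cpx0.
Proof.
apply/eqP; case=> h; exact: R1_neq_R0 h.
Qed.

HB.instance Definition _ :=
  GRing.Zmodule_isComNzRing.Build cpx cpx_mulA cpx_mulC cpx_mul1 cpx_mulDl
    cpx_one_neq0.

Definition rC (r : R) : cpx := Cpx r rzero.

(* Extended nonnegative reals [0, oo] (carrier: R + {oo})              *)

Inductive ereal := EFin of R | EInf.

Definition ele (x y : ereal) : Prop :=
  match x, y with
  | _, EInf => True
  | EInf, EFin _ => False
  | EFin a, EFin b => Rle a b
  end.

(* multiplication by a nonnegative real scalar, with 0 * oo = 0 *)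
Definition escale (c : R) (x : ereal) : ereal :=
  match x with
  | EFin a => EFin (Rmult c a)
  | EInf => if Req_EM_T c rzero then EFin rzero else EInf
  end.

Definition is_esup (S : ereal -> Prop) (v : ereal) : Prop :=
  (forall x, S x -> ele x v) /\ (forall u, (forall x, S x -> ele x u) -> ele v u).
Definition is_einf (S : ereal -> Prop) (v : ereal) : Prop :=
  (forall x, S x -> ele v x) /\ (forall u, (forall x, S x -> ele u x) -> ele u v).

Definition esup (S : ereal -> Prop) : ereal :=
  epsilon (inhabits (EFin rzero)) (is_esup S).
Definition einf (S : ereal -> Prop) : ereal :=
  epsilon (inhabits (EFin rzero)) (is_einf S).

Definition econv (u : nat -> ereal) (l : ereal) : Prop :=
  match l with
  | EFin a => forall eps, Rlt rzero eps -> exists N, forall n, (N <= n)%N ->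
                exists x, u n = EFin x /\ Rlt (Rabs (Rminus x a)) eps
  | EInf => forall M : R, exists N, forall n, (N <= n)%N -> ele (EFin M) (u n)
  end.

Definition elim (u : nat -> ereal) : ereal :=
  epsilon (inhabits (EFin rzero)) (econv u).

Local Open Scope ring_scope.

Notation Mx d := ('M[cpx]_d).

Definition adj m n (A : 'M[cpx]_(m, n)) : 'M[cpx]_(n, m) :=
  \matrix_(i, j) cpx_conj (A j i).

Definition hermitian n (A : Mx n) : Prop := adj A = A.

Definition psd n (A : Mx n) : Prop :=
  forall v : 'cV[cpx]_n,
    Im ((adj v *m A *m v) ord0 ord0) = rzero /\ Rle rzero (Re ((adj v *m A *m v) ord0 ord0)).

Definition is_state n (rho : Mx n) : Prop := psd rho /\ \tr rho = 1.

(* splitting an index of C^m (x) C^n into its two components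
   (inverse of mathcomp's mxvec_index, lexicographic order) *)
Definition idx m n (k : 'I_(m * n)) : 'I_m * 'I_n :=
  enum_val (cast_ord (esym (@mxvec_cast m n)) k).

Definition kron m1 n1 m2 n2 (A : 'M[cpx]_(m1, n1)) (B : 'M[cpx]_(m2, n2))
  : 'M[cpx]_(m1 * m2, n1 * n2) :=
  \matrix_(k, l) (A (idx k).1 (idx l).1 * B (idx k).2 (idx l).2).

Definition tensmap a1 a2 b1 b2 (f : Mx a1 -> Mx a2) (g : Mx b1 -> Mx b2)
  (X : Mx (a1 * b1)) : Mx (a2 * b2) :=
  \sum_(i : 'I_a1) \sum_(j : 'I_a1) \sum_(k : 'I_b1) \sum_(l : 'I_b1)
     X (mxvec_index i k) (mxvec_index j l) *:
       kron (f (delta_mx i j)) (g (delta_mx k l)).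

Definition tensI a1 a2 (f : Mx a1 -> Mx a2) (k : nat) : Mx (a1 * k) -> Mx (a2 * k) :=
  tensmap f (@id (Mx k)).
Arguments tensI {a1 a2} f k _.

Definition is_linmap a1 a2 (f : Mx a1 -> Mx a2) : Prop :=
  forall (c : cpx) (X Y : Mx a1), f (c *: X + Y) = c *: f X + f Y.

Definition is_CP a1 a2 (f : Mx a1 -> Mx a2) : Prop :=
  forall k, (0 < k)%N -> forall X : Mx (a1 * k), psd X -> psd (tensI f k X).

Definition is_TP a1 a2 (f : Mx a1 -> Mx a2) : Prop :=
  forall X, \tr (f X) = \tr X.

Definition is_channel a1 a2 (f : Mx a1 -> Mx a2) : Prop :=
  [/\ is_linmap f, is_CP f & is_TP f].

Definition is_tangent a1 a2 (D : Mx a1 -> Mx a2) : Prop :=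
  [/\ is_linmap D, (forall X, hermitian X -> hermitian (D X))
    & (forall X, \tr (D X) = 0)].

Definition rscale a1 a2 (t : R) (D : Mx a1 -> Mx a2) : Mx a1 -> Mx a2 :=
  fun X => rC t *: D X.

Fixpoint tpow (d n : nat) : nat :=
  match n with O => 1%N | S n' => (tpow d n' * d)%N end.

Fixpoint tpowmap a1 a2 (f : Mx a1 -> Mx a2) (n : nat)
  : Mx (tpow a1 n) -> Mx (tpow a2 n) :=
  match n as n0 return Mx (tpow a1 n0) -> Mx (tpow a2 n0) with
  | O => fun X => X
  | S n' => tensmap (@tpowmap a1 a2 f n') f
  end.
Arguments tpowmap {a1 a2} f n _.

(* Delta^{(n)} = sum_k Phi^{(x)(k-1)} (x) Delta (x) Phi^{(x)(n-k)},
   computed recursively: Delta^{(n+1)} = Delta^{(n)} (x) Phi + Phi^{(x)n} (x) Delta *)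
Fixpoint dpow a1 a2 (f D : Mx a1 -> Mx a2) (n : nat)
  : Mx (tpow a1 n) -> Mx (tpow a2 n) :=
  match n as n0 return Mx (tpow a1 n0) -> Mx (tpow a2 n0) with
  | O => fun _ => 0
  | S n' => fun X => tensmap (@dpow a1 a2 f D n') f X + tensmap (@tpowmap a1 a2 f n') D X
  end.
Arguments dpow {a1 a2} f D n _.

Definition rsum m (v : 'I_m -> R) : R := \big[Rplus/rzero]_(y < m) v y.

Definition is_dist m (p : 'I_m -> R) : Prop :=
  (forall y, Rle rzero (p y)) /\ rsum p = rone.

Definition is_cl_tangent m (d : 'I_m -> R) : Prop := rsum d = rzero.

(* J_p(delta) with the conventions 0/0 = 0, c/0 = oo *)
Definition Jfisher m (p d : 'I_m -> R) : ereal :=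
  if excluded_middle_informative (exists y, p y = rzero /\ d y <> rzero) then EInf
  else EFin (\big[Rplus/rzero]_(y < m)
               (if Req_EM_T (p y) rzero then rzero else Rdiv (Rmult (d y) (d y)) (p y))).

Definition dmx m (v : 'I_m -> R) : Mx m := diag_mx (\row_i rC (v i)).

(* a vector on a finite set seen as a (linear) map from C = C^1 *)
Definition cl_map m (v : 'I_m -> R) : Mx 1 -> Mx m := fun X => X ord0 ord0 *: dmx v.

Definition is_povm n m (M : 'I_m -> Mx n) : Prop :=
  (forall y, psd (M y)) /\ \sum_(y < m) M y = 1%:M.

Definition povm_out n m (M : 'I_m -> Mx n) (s : Mx n) : 'I_m -> R :=
  fun y => Re (\tr (s *m M y)).

Definition cmetric : Type :=
  forall a1 a2 : nat, (Mx a1 -> Mx a2) -> (Mx a1 -> Mx a2) -> ereal.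

Definition is_channel_metric (G : cmetric) : Prop :=
  forall a1 a2 (Phi D : Mx a1 -> Mx a2), (0 < a1)%N -> (0 < a2)%N ->
    is_channel Phi -> is_tangent D ->
    ele (EFin rzero) (G _ _ Phi D) /\
    forall t : R, G _ _ Phi (rscale t D) = escale (Rmult t t) (G _ _ Phi D).

Definition axiom_M (G : cmetric) : Prop :=
  (forall a0 a1 a2 (Phi D : Mx a1 -> Mx a2) (Psi : Mx a0 -> Mx a1),
     (0 < a0)%N -> (0 < a1)%N -> (0 < a2)%N ->
     is_channel Phi -> is_tangent D -> is_channel Psi ->
     ele (G _ _ (fun X => Phi (Psi X)) (fun X => D (Psi X))) (G _ _ Phi D)) /\
  (forall a1 a2 a3 (Phi D : Mx a1 -> Mx a2) (Psi : Mx a2 -> Mx a3),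
     (0 < a1)%N -> (0 < a2)%N -> (0 < a3)%N ->
     is_channel Phi -> is_tangent D -> is_channel Psi ->
     ele (G _ _ (fun X => Psi (Phi X)) (fun X => Psi (D X))) (G _ _ Phi D)).

Definition axiom_E (G : cmetric) : Prop :=
  forall a1 a2 (Phi D : Mx a1 -> Mx a2) k,
    (0 < a1)%N -> (0 < a2)%N -> (0 < k)%N ->
    is_channel Phi -> is_tangent D ->
    G _ _ (tensI Phi k) (tensI D k) = G _ _ Phi D.

Definition axiom_N (G : cmetric) : Prop :=
  forall m (p d : 'I_m -> R), is_dist p -> is_cl_tangent d ->
    G _ _ (cl_map p) (cl_map d) = Jfisher p d.

Definition regseq (G : cmetric) a1 a2 (Phi D : Mx a1 -> Mx a2) : nat -> ereal :=
  fun n => escale (Rinv (INR n)) (G _ _ (tpowmap Phi n) (dpow Phi D n)).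

Definition axiom_Ap (G : cmetric) : Prop :=
  forall a1 a2 (Phi D : Mx a1 -> Mx a2), (0 < a1)%N -> (0 < a2)%N ->
    is_channel Phi -> is_tangent D ->
    econv (regseq G Phi D) (G _ _ Phi D).

Definition Gmin : cmetric := fun a1 a2 Phi D =>
  esup (fun v => exists k (rho : Mx (a1 * k)) m (M : 'I_m -> Mx (a2 * k)),
          [/\ (0 < k)%N, is_state rho, is_povm M &
              v = Jfisher (povm_out M (tensI Phi k rho)) (povm_out M (tensI D k rho))]).

Definition Gmax : cmetric := fun a1 a2 Phi D =>
  einf (fun v => exists m (q d : 'I_m -> R) (Lam : Mx (a1 * m) -> Mx a2),
          [/\ is_dist q, is_cl_tangent d, is_channel Lam,
              (forall X, Phi X = Lam (kron X (dmx q))) /\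
              (forall X, D X = Lam (kron X (dmx d))) &
              v = Jfisher q d]).

Definition Gminp : cmetric := fun a1 a2 Phi D => elim (regseq Gmin Phi D).
Definition Gmaxp : cmetric := fun a1 a2 Phi D => elim (regseq Gmax Phi D).

(* Main.v *)
Require Import Defs.
From Stdlib Require Import Reals Lra FunctionalExtensionality PropExtensionality.
From Stdlib Require Import ClassicalEpsilon.
From HB Require Import structures.
From mathcomp Require Import all_boot all_order all_algebra.

(** Order pairs (channel, tangent) by [P <~ Q] when [P] arises from [Q] by pre- and
    post-processing with channels.  With the product
    (Phi, D) (x) (Psi, E) = (Phi (x) Psi, D (x) Psi + Phi (x) E), so that the n-th power of
    (Phi, D) is (Phi^n, D^(n)), this is a symmetric monoidal preorder whose unit lies below
    every pair.  Writing I for an identity channel with zero tangent, G^min(P) is the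
    supremum of J(c) over classical pairs c with c <~ P (x) I, and G^max(P) is the infimum of
    J(c) over those with P <~ c (x) I.  As J is additive on products, G^min is superadditive
    and G^max subadditive, and Fekete's lemma gives the limits.  A metric with (M), (E), (N)
    lies between G^min and G^max, and (Ap) carries this over to the limits.  The axioms for
    the limits follow from the relations between powers; for (N) one uses
    J <= G^min <= G^min,p <= G = J on classical pairs, and dually for G^max,p. *)

Set Implicit Arguments.
Unset Strict Implicit.
Unset Printing Implicit Defensive.

Import GRing.Theory.
Local Open Scope ring_scope.
Delimit Scope R_scope with coqR.
Local Notation hermitian := Defs.hermitian.

(** * Complex scalars *)

(** The matrix types of [P \ox Q \ox S] and [P \ox (Q \ox S)] differ, and pairs carry proofs, so the
    laws of the tensor product are not stated as equalities of pairs. They appear as [<~] relations,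
    and two opposite ones become an equality of values under any monotone functional.

    Most of the work on matrices goes into showing that concrete maps are channels. Positivity is a
    condition on quadratic forms, so measure-and-prepare maps are given Kraus operators, built from
    a Cholesky decomposition. States and measurements are then channels themselves, which is what
    lets [Gmin] and [Gmax], defined through states, effects and simulations, be read off the
    preorder.

    Infinite values are genuine limits here: a pair may have no finite simulation, and a classical
    tangent may leave the support of its distribution. Fekete's lemma, the additivity of [Jfisher]
    and the sums of extrema are therefore proved with infinite terms. *)

Lemma cpx_ext (a b : cpx) : Re a = Re b -> Im a = Im b -> a = b.
Proof. by case: a b => [x y] [x' y'] /= -> ->. Qed.

Lemma ReD (a b : cpx) : Re (a + b) = (Re a + Re b)%coqR. Proof. by []. Qed.
Lemma ImD (a b : cpx) : Im (a + b) = (Im a + Im b)%coqR. Proof. by []. Qed.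
Lemma ReN (a : cpx) : Re (- a) = (- Re a)%coqR. Proof. by []. Qed.
Lemma ImN (a : cpx) : Im (- a) = (- Im a)%coqR. Proof. by []. Qed.
Lemma ReM (a b : cpx) : Re (a * b) = (Re a * Re b - Im a * Im b)%coqR.
Proof. by []. Qed.
Lemma ImM (a b : cpx) : Im (a * b) = (Re a * Im b + Im a * Re b)%coqR.
Proof. by []. Qed.
Lemma Re0 : Re 0 = rzero. Proof. by []. Qed.
Lemma Im0 : Im 0 = rzero. Proof. by []. Qed.
Lemma Re1 : Re 1 = rone. Proof. by []. Qed.
Lemma Im1 : Im 1 = rzero. Proof. by []. Qed.
Lemma ReC (a : cpx) : Re (cpx_conj a) = Re a. Proof. by []. Qed.
Lemma ImC (a : cpx) : Im (cpx_conj a) = (- Im a)%coqR. Proof. by []. Qed.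
Lemma RerC r : Re (rC r) = r. Proof. by []. Qed.
Lemma ImrC r : Im (rC r) = rzero. Proof. by []. Qed.

Definition cpxE :=
  (ReD, ImD, ReN, ImN, ReM, ImM, Re0, Im0, Re1, Im1, ReC, ImC, RerC, ImrC).

Ltac cpx_ring := apply: cpx_ext; rewrite ?cpxE; ring.

Lemma conj_is_zmod_morphism : zmod_morphism cpx_conj.
Proof. by move=> a b; cpx_ring. Qed.
Lemma conj_is_monoid_morphism : monoid_morphism cpx_conj.
Proof. by split=> [|a b]; cpx_ring. Qed.
HB.instance Definition _ :=
  GRing.isZmodMorphism.Build cpx cpx cpx_conj conj_is_zmod_morphism.
HB.instance Definition _ :=
  GRing.isMonoidMorphism.Build cpx cpx cpx_conj conj_is_monoid_morphism.

Lemma conjK a : cpx_conj (cpx_conj a) = a.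
Proof. by cpx_ring. Qed.

Lemma rCD x y : rC (x + y)%coqR = rC x + rC y. Proof. by cpx_ring. Qed.
Lemma rCM x y : rC (x * y)%coqR = rC x * rC y. Proof. by cpx_ring. Qed.

Lemma rC_sum m (v : 'I_m -> R) : rC (rsum v) = \sum_i rC (v i).
Proof.
by rewrite /rsum; elim/big_rec2: _ => [|i y1 y2 _ <-] //; rewrite rCD.
Qed.

(** * Adjoints and positive semidefinite matrices *)

Lemma adjE m n (A : 'M[cpx]_(m, n)) : adj A = (map_mx cpx_conj A)^T.
Proof. by apply/matrixP=> i j; rewrite !mxE. Qed.

Lemma adjM m n p (A : 'M[cpx]_(m, n)) (B : 'M_(n, p)) :
  adj (A *m B) = adj B *m adj A.
Proof. by rewrite !adjE map_mxM trmx_mul. Qed.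

Lemma adjK m n (A : 'M[cpx]_(m, n)) : adj (adj A) = A.
Proof. by apply/matrixP=> i j; rewrite !mxE conjK. Qed.

Lemma adjD m n (A B : 'M[cpx]_(m, n)) : adj (A + B) = adj A + adj B.
Proof. by apply/matrixP=> i j; rewrite !mxE rmorphD. Qed.

Lemma adjZ m n c (A : 'M[cpx]_(m, n)) : adj (c *: A) = cpx_conj c *: adj A.
Proof. by apply/matrixP=> i j; rewrite !mxE rmorphM. Qed.

Lemma adj_sum m n (I : Type) (s : seq I) (A : I -> 'M[cpx]_(m, n)) :
  adj (\sum_(i <- s) A i) = \sum_(i <- s) adj (A i).
Proof.
elim: s => [|i s IH]; last by rewrite !big_cons adjD IH.
by rewrite !big_nil; apply/matrixP=> i j; rewrite !mxE rmorph0.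
Qed.

Lemma adj_delta m n i j : adj (delta_mx i j : 'M[cpx]_(m, n)) = delta_mx j i.
Proof. by apply/matrixP=> k l; rewrite !mxE rmorph_nat andbC. Qed.

Definition qform n (A : Mx n) (v : 'cV_n) : cpx := (adj v *m A *m v) ord0 ord0.

Lemma mxZE m n c (A : 'M[cpx]_(m, n)) i j : (c *: A) i j = c * A i j.
Proof. by rewrite mxE. Qed.

Lemma mxDE m n (A B : 'M[cpx]_(m, n)) i j : (A + B) i j = A i j + B i j.
Proof. by rewrite mxE. Qed.

Lemma mxBE m n (A B : 'M[cpx]_(m, n)) i j : (A - B) i j = A i j - B i j.
Proof. by rewrite !mxE. Qed.

Lemma mul_deltaE m n (A : 'M[cpx]_(m, n)) k i :
  (A *m delta_mx k (ord0 : 'I_1)) i ord0 = A i k.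
Proof. by have /matrixP/(_ i 0) := colE k A; rewrite mxE => ->. Qed.

Lemma delta_mulE m n (A : 'M[cpx]_(m, n)) k i :
  (delta_mx (ord0 : 'I_1) k *m A) ord0 i = A k i.
Proof. by have /matrixP/(_ 0 i) := rowE k A; rewrite mxE => ->. Qed.

(** With [v] a basis vector this gives the polarization formula [qform_pair]; with [v] arbitrary it
    is the completed square in [psd_schur]. *)
Lemma qformD_delta n (A : Mx n) (v : 'cV_n) c k :
  qform A (v + c *: delta_mx k ord0) =
  qform A v + c * (adj v *m A) ord0 k + cpx_conj c * (A *m v) k ord0
  + cpx_conj c * c * A k k.
Proof.
rewrite /qform adjD adjZ adj_delta !mulmxDl !mulmxDr -!scalemxAl -!scalemxAr.
rewrite addrA !(mxDE, mxZE) mul_deltaE -(mulmxA (delta_mx _ _) A v) delta_mulE.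
rewrite -!addrA; congr (_ + (_ + (_ + _))).
by rewrite mul_deltaE delta_mulE; cpx_ring.
Qed.

Lemma qform_delta n (A : Mx n) i : qform A (delta_mx i ord0) = A i i.
Proof. by rewrite /qform adj_delta mul_deltaE delta_mulE. Qed.

Lemma qform_pair n (A : Mx n) i j c :
  qform A (delta_mx i ord0 + c *: delta_mx j ord0) =
  A i i + c * A i j + cpx_conj c * A j i + cpx_conj c * c * A j j.
Proof. by rewrite qformD_delta qform_delta adj_delta delta_mulE mul_deltaE. Qed.

Lemma psd_diag n (A : Mx n) i : psd A -> Im (A i i) = rzero /\ (rzero <= Re (A i i))%coqR.
Proof. by move=> /(_ (delta_mx i ord0)); rewrite -/(qform A _) qform_delta. Qed.

(** Polarization: a real form at [e_i + e_j] gives Im (A i j + A j i) = 0, and at [e_i + i e_j] it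
    gives Re (A i j - A j i) = 0. *)
Lemma psd_herm n (A : Mx n) : psd A -> hermitian A.
Proof.
move=> hA; apply/matrixP=> i j; rewrite mxE.
have [h1 _] := hA (delta_mx i ord0 + 1 *: delta_mx j ord0).
have [h2 _] := hA (delta_mx i ord0 + Cpx rzero rone *: delta_mx j ord0).
have [hi _] := psd_diag i hA; have [hj _] := psd_diag j hA.
move: h1 h2; rewrite -!/(qform A _) !qform_pair !cpxE /= hi hj => h1 h2.
by apply: cpx_ext; rewrite !cpxE; lra.
Qed.

Lemma psd_conj m n (A : Mx n) (B : 'M_(m, n)) : psd A -> psd (B *m A *m adj B).
Proof.
by move=> hA v; have := hA (adj B *m v); rewrite adjM adjK !mulmxA.
Qed.

Lemma psd0 n : psd (0 : Mx n).
Proof. by move=> v; rewrite mulmx0 mul0mx mxE; split; [|exact: Rle_refl]. Qed.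

Lemma psdD n (A B : Mx n) : psd A -> psd B -> psd (A + B).
Proof.
move=> hA hB v; rewrite mulmxDr mulmxDl mxE !cpxE.
have [e1 h1] := hA v; have [e2 h2] := hB v; rewrite e1 e2; split; first by ring.
exact: Rplus_le_le_0_compat h1 h2.
Qed.

Lemma psd_sum n (I : Type) (s : seq I) (A : I -> Mx n) :
  (forall i, psd (A i)) -> psd (\sum_(i <- s) A i).
Proof. by move=> hA; elim/big_rec: _ => [|i B _]; [apply: psd0 | apply: psdD]. Qed.

Lemma psd_scalar1 n : psd (1%:M : Mx n).
Proof.
move=> v; rewrite mulmx1 mxE; elim/big_rec: _ => [|i a _ [h1 h2]].
  by split; [|exact: Rle_refl].
have Ib b : Im (cpx_conj b * b) = rzero by rewrite !cpxE; ring.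
have Rb b : Rle rzero (Re (cpx_conj b * b)) by rewrite !cpxE; nra.
rewrite ReD ImD h1 mxE Ib; split; first by ring.
exact: Rplus_le_le_0_compat (Rb _) h2.
Qed.

Lemma psd_outer n (v : 'cV[cpx]_n) : psd (v *m adj v).
Proof. by rewrite -[v]mulmx1; have := psd_conj v (@psd_scalar1 1); rewrite !mulmx1. Qed.

(* One Schur-complement step of the Cholesky decomposition. *)
Lemma psd_schur n (A : Mx n) k : psd A ->
  exists v : 'cV[cpx]_n, [/\ psd (A - v *m adj v),
    (forall i, A i k = 0 -> v i ord0 = 0),
    (forall i, (A - v *m adj v) i k = 0) & forall i, (A - v *m adj v) k i = 0].
Proof.
move=> hA; have hH := psd_herm hA; have [hI hR] := psd_diag k hA.
have sym i j : A j i = cpx_conj (A i j) by rewrite -{1}hH mxE.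
case: (Req_EM_T (Re (A k k)) rzero) => [h0|h0].
  have col0 i : A i k = 0.
    have [hi1 hi2] := psd_diag i hA.
    (* If [A i k] were nonzero, this [t] would make the form equal to -1 at the test vector below,
       because [A k k] vanishes. *)
    pose t := ((Re (A i i) + 1) / (2 * (Re (A i k) * Re (A i k) + Im (A i k) * Im (A i k))))%coqR.
    have [_] := hA (delta_mx i ord0 + (rC (- t)%coqR * cpx_conj (A i k)) *: delta_mx k ord0).
    rewrite -/(qform A _) qform_pair (sym i k) !cpxE h0 hI /t.
    set x := Re (A i k); set y := Im (A i k) => h.
    case: (Req_EM_T (x * x + y * y)%coqR rzero) => [hz|hz].
      by apply: cpx_ext; rewrite !cpxE -/x -/y; nra.
    exfalso; move: h.
    set q := (_ / _)%coqR.
    have hq : (q * (x * x + y * y) = (Re (A i i) + 1) / 2)%coqR.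
      by rewrite /q; field.
    nra.
  exists 0; rewrite mul0mx subr0; split=> // i; first by rewrite mxE.
  by rewrite sym col0 rmorph0.
have ha : (rzero < Re (A k k))%coqR by lra.
pose a := Re (A k k); pose s := sqrt a.
have hs : (s * s = a)%coqR by apply: sqrt_sqrt.
have s0 : (0 < s)%coqR by apply: sqrt_lt_R0.
(* Column [k] over the square root of [A k k]: then [v *m adj v] agrees with [A] in row and column
   [k]. *)
pose v : 'cV[cpx]_n := rC (/ s)%coqR *: col k A.
have hss : (/ s * / s = / a)%coqR by rewrite -hs Rinv_mult.
have vv i j : (v *m adj v) i j = rC (/ a)%coqR * (A i k * cpx_conj (A j k)).
  rewrite mxE big_ord1 !mxE rmorphM -hss rCM.
  by apply: cpx_ext; rewrite !cpxE; ring.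
have Akk : A k k = rC a by apply: cpx_ext.
have ai : (/ a * a = 1)%coqR by rewrite Rinv_l.
exists v; split.
- move=> x; rewrite mulmxBr mulmxBl.
  pose z := (A *m x) k ord0.
  have hz : (adj x *m A) ord0 k = cpx_conj z by rewrite -{1}hH -adjM mxE.
  have hv : (adj x *m (v *m adj v) *m x) ord0 ord0 = rC (/ a)%coqR * (cpx_conj z * z).
    have -> : adj x *m (v *m adj v) *m x = (adj x *m v) *m (adj v *m x).
      by rewrite !mulmxA.
    rewrite mxE big_ord1.
    have -> : (adj v *m x) ord0 ord0 = rC (/ s)%coqR * z.
      rewrite /z !mxE mulr_sumr; apply: eq_bigr => i _.
      by rewrite !mxE (sym i k) rmorphM mulrA; congr (_ * _ * _); cpx_ring.
    have -> : (adj x *m v) ord0 ord0 = rC (/ s)%coqR * cpx_conj z.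
      rewrite -hz !mxE mulr_sumr; apply: eq_bigr => i _.
      by rewrite /v !mxE mulrCA.
    by rewrite -hss rCM; cpx_ring.
  (* Completing the square: the form of [A - v *m adj v] at [x] is the form of [A] at
     [x - (z / a) e_k]. *)
  have := hA (x + (- rC (/ a)%coqR * z) *: delta_mx k ord0).
  rewrite -/(qform A _) qformD_delta -/z hz Akk.
  suff -> : (adj x *m A *m x - adj x *m (v *m adj v) *m x) ord0 ord0 =
     qform A x + - rC (/ a)%coqR * z * cpx_conj z +
     cpx_conj (- rC (/ a)%coqR * z) * z +
     cpx_conj (- rC (/ a)%coqR * z) * (- rC (/ a)%coqR * z) * rC a by [].
  rewrite mxBE hv -/(qform A x).
  apply: cpx_ext; rewrite !cpxE.
    suff e : forall w : R, (/ a * / a * a * w = / a * w)%coqR.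
      have := e (Re z * Re z)%coqR; have := e (Im z * Im z)%coqR; nra.
    move=> w; transitivity ((/ a * a) * (/ a * w))%coqR; first by ring.
    by rewrite ai; ring.
  ring.
- by move=> i hi; rewrite /v !mxE hi mulr0.
- move=> i; rewrite mxBE vv Akk.
  have -> : rC (/ a)%coqR * (A i k * cpx_conj (rC a)) = A i k * rC (/ a * a)%coqR.
    by rewrite rCM; cpx_ring.
  by rewrite ai; cpx_ring.
- move=> i; rewrite mxBE vv Akk -sym.
  have -> : rC (/ a)%coqR * (rC a * A k i) = A k i * rC (/ a * a)%coqR.
    by rewrite rCM; cpx_ring.
  by rewrite ai; cpx_ring.
Qed.

(** Indices are cleared one at a time. Because the vector of [psd_schur] vanishes wherever column
    [k] does, rows and columns cleared earlier stay zero. *)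
Lemma psd_cholesky n (A : Mx n) : psd A ->
  exists s : seq 'cV[cpx]_n, A = \sum_(v <- s) v *m adj v.
Proof.
move=> hA.
have step m : exists s : seq 'cV[cpx]_n,
    psd (A - \sum_(v <- s) v *m adj v) /\
    forall i j : 'I_n, (i < m)%N || (j < m)%N -> (A - \sum_(v <- s) v *m adj v) i j = 0.
  elim: m => [|m [s [hp h0]]]; first by exists [::]; rewrite big_nil subr0.
  case: (ltnP m n) => hmn; last first.
    by exists s; split=> // i j _; apply: h0; rewrite (leq_trans (ltn_ord i)).
  have [v [hv1 hv2 hv3 hv4]] := psd_schur (Ordinal hmn) hp.
  exists (v :: s); rewrite big_cons [_ + \sum_(_ <- _) _]addrC opprD addrA.
  split=> // i j; rewrite !ltnS; case: (ltngtP i m) => [im _|_|im _] /=.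
  - rewrite mxBE h0 ?im // mxE big_ord1 hv2 ?mul0r ?subr0 //.
    by rewrite h0 // im.
  - case: (ltngtP j m) => // [jm _|jm _].
      rewrite mxBE h0 ?jm ?orbT // mxE big_ord1 [adj v _ _]mxE hv2 ?rmorph0 ?mulr0 ?subr0 //.
      by rewrite h0 // jm.
    by rewrite (_ : j = Ordinal hmn) ?hv3 //; apply: val_inj.
  - by rewrite (_ : i = Ordinal hmn) ?hv4 //; apply: val_inj.
have [s [_ h]] := step n; exists s; apply/eqP; rewrite -subr_eq0; apply/eqP/matrixP=> i j.
by rewrite h ?mxE ?ltn_ord.
Qed.

(** * Tensor products of matrices and of linear maps *)

Lemma idx_mxvec m n (i : 'I_m) (j : 'I_n) : idx (mxvec_index i j) = (i, j).
Proof. by rewrite /idx /mxvec_index cast_ordK enum_rankK. Qed.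

Lemma mxvec_idx m n (k : 'I_(m * n)) : mxvec_index (idx k).1 (idx k).2 = k.
Proof. by case/mxvec_indexP: k => i j; rewrite idx_mxvec. Qed.

Lemma mxvec_index_eq m n (i k : 'I_m) (j l : 'I_n) :
  (mxvec_index i j == mxvec_index k l) = (i == k) && (j == l).
Proof.
apply/eqP/andP => [h|[/eqP-> /eqP->] //].
by have := idx_mxvec i j; rewrite h idx_mxvec => -[-> ->].
Qed.

Lemma big_mxvec (T : Type) (x : T) (op : Monoid.com_law x) m n (F : 'I_(m * n) -> T) :
  \big[op/x]_(k < m * n) F k =
  \big[op/x]_(i < m) \big[op/x]_(j < n) F (mxvec_index i j).
Proof.
rewrite pair_big (reindex _ (curry_mxvec_bij m n)) /=.
by apply: eq_bigr => -[].
Qed.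

Lemma kronE m1 n1 m2 n2 (A : 'M[cpx]_(m1, n1)) (B : 'M[cpx]_(m2, n2)) i j k l :
  kron A B (mxvec_index i j) (mxvec_index k l) = A i k * B j l.
Proof. by rewrite mxE !idx_mxvec. Qed.

Lemma mxvec_matrixP m1 n1 m2 n2 (A B : 'M[cpx]_(m1 * m2, n1 * n2)) :
  (forall i j k l, A (mxvec_index i j) (mxvec_index k l) =
                   B (mxvec_index i j) (mxvec_index k l)) -> A = B.
Proof.
move=> h; apply/matrixP=> p q; case/mxvec_indexP: p => i j.
by case/mxvec_indexP: q => k l.
Qed.

Lemma kronM m1 n1 p1 m2 n2 p2 (A : 'M[cpx]_(m1, n1)) (B : 'M[cpx]_(m2, n2))
    (A' : 'M[cpx]_(n1, p1)) (B' : 'M[cpx]_(n2, p2)) :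
  kron A B *m kron A' B' = kron (A *m A') (B *m B').
Proof.
apply: mxvec_matrixP => i j k l; rewrite kronE !mxE big_mxvec big_distrlr /=.
by apply: eq_bigr => p _; apply: eq_bigr => q _; rewrite !kronE mulrACA.
Qed.

Lemma adj_kron m1 n1 m2 n2 (A : 'M[cpx]_(m1, n1)) (B : 'M[cpx]_(m2, n2)) :
  adj (kron A B) = kron (adj A) (adj B).
Proof.
by apply: mxvec_matrixP => i j k l; rewrite kronE mxE kronE !mxE rmorphM.
Qed.

Lemma mxtrace_kron m n (A : Mx m) (B : Mx n) : \tr (kron A B) = \tr A * \tr B.
Proof.
rewrite /mxtrace big_mxvec big_distrlr /=.
by apply: eq_bigr => i _; apply: eq_bigr => j _; rewrite kronE.
Qed.

Lemma kron_delta m1 n1 m2 n2 i j k l :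
  kron (delta_mx i k : 'M[cpx]_(m1, n1)) (delta_mx j l : 'M[cpx]_(m2, n2)) =
  delta_mx (mxvec_index i j) (mxvec_index k l).
Proof.
apply: mxvec_matrixP => i' j' k' l'; rewrite kronE !mxE.
by rewrite !mxvec_index_eq -natrM mulnb andbACA.
Qed.

(** * Linear maps and the tensor product of maps *)

Section Linear.
Variables (a b : nat) (f : Mx a -> Mx b).
Hypothesis lf : is_linmap f.

Lemma linD X Y : f (X + Y) = f X + f Y.
Proof. by have := lf 1 X Y; rewrite !scale1r. Qed.

Lemma lin0 : f 0 = 0.
Proof. by apply: (addrI (f 0)); rewrite -linD !addr0. Qed.

Lemma linZ c X : f (c *: X) = c *: f X.
Proof. by have := lf c X 0; rewrite lin0 !addr0. Qed.

Lemma lin_sum (I : Type) (s : seq I) (F : I -> Mx a) :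
  f (\sum_(i <- s) F i) = \sum_(i <- s) f (F i).
Proof.
by elim: s => [|i s IH]; rewrite ?big_nil ?lin0 // !big_cons linD IH.
Qed.

Lemma lin_delta X : f X = \sum_i \sum_j X i j *: f (delta_mx i j).
Proof.
rewrite {1}(matrix_sum_delta X) lin_sum; apply: eq_bigr => i _.
by rewrite lin_sum; apply: eq_bigr => j _; rewrite linZ.
Qed.
End Linear.

Lemma lin_id a : is_linmap (@id (Mx a)). Proof. by []. Qed.

Lemma lin_zero a b : is_linmap (fun _ : Mx a => 0 : Mx b).
Proof. by move=> c X Y; rewrite scaler0 addr0. Qed.

Lemma lin_comp a b c (f : Mx b -> Mx c) (g : Mx a -> Mx b) :
  is_linmap f -> is_linmap g -> is_linmap (fun X => f (g X)).
Proof. by move=> lf lg s X Y; rewrite lg lf. Qed.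

Lemma lin_add a b (f g : Mx a -> Mx b) :
  is_linmap f -> is_linmap g -> is_linmap (fun X => f X + g X).
Proof. by move=> lf lg s X Y; rewrite lf lg scalerDr addrACA. Qed.

Lemma lin_bigsum a b (I : Type) (s : seq I) (f : I -> Mx a -> Mx b) :
  (forall i, is_linmap (f i)) -> is_linmap (fun X => \sum_(i <- s) f i X).
Proof.
move=> lf c X Y; rewrite scaler_sumr -big_split.
by apply: eq_bigr => i _; rewrite lf.
Qed.

Lemma lin_scaled a b (h : Mx a -> cpx) (A : Mx b) :
  (forall c X Y, h (c *: X + Y) = c * h X + h Y) -> is_linmap (fun X => h X *: A).
Proof. by move=> hh c X Y; rewrite hh scalerDl scalerA. Qed.

Lemma lin_rscale a b t (f : Mx a -> Mx b) : is_linmap f -> is_linmap (rscale t f).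
Proof. by move=> lf c X Y; rewrite /rscale lf scalerDr !scalerA mulrC. Qed.

Lemma lin_mxsub a b (s : 'I_b -> 'I_a) : is_linmap (mxsub s s).
Proof. by move=> c X Y; apply/matrixP=> i j; rewrite !mxE. Qed.

Lemma lin_conj a b (A : 'M[cpx]_(b, a)) : is_linmap (fun X => A *m X *m adj A).
Proof. by move=> c X Y; rewrite mulmxDr mulmxDl -scalemxAr -scalemxAl. Qed.

Lemma kron_linl a b (B : Mx b) : is_linmap (fun A : Mx a => kron A B).
Proof.
by move=> c X Y; apply: mxvec_matrixP => i j k l; rewrite !(mxDE, mxZE, kronE) mulrDl mulrA.
Qed.

Lemma kron_linr a b (A : Mx a) : is_linmap (fun B : Mx b => kron A B).
Proof.
by move=> c X Y; apply: mxvec_matrixP => i j k l; rewrite !(mxDE, mxZE, kronE) mulrDr mulrCA.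
Qed.

Lemma lin_tens a1 a2 b1 b2 (f : Mx a1 -> Mx a2) (g : Mx b1 -> Mx b2) :
  is_linmap (tensmap f g).
Proof.
rewrite /tensmap; do 4! apply: lin_bigsum => ?.
by apply: lin_scaled => c X Y; rewrite !mxE.
Qed.

Lemma tens_kron a1 a2 b1 b2 (f : Mx a1 -> Mx a2) (g : Mx b1 -> Mx b2) A B :
  is_linmap f -> is_linmap g -> tensmap f g (kron A B) = kron (f A) (g B).
Proof.
move=> lf lg; rewrite (lin_delta (lin_comp (@kron_linl _ _ (g B)) lf)) /tensmap.
apply: eq_bigr => i _; apply: eq_bigr => j _.
rewrite (lin_delta (lin_comp (@kron_linr _ _ (f (delta_mx i j))) lg)) scaler_sumr.
apply: eq_bigr => k _; rewrite scaler_sumr; apply: eq_bigr => l _.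
by rewrite kronE scalerA.
Qed.

(** Product matrices span, by [kron_delta]. Identities between tensor maps are checked on them,
    where [tens_kron] computes, and not on the fourfold sum of [tensmap]. *)
Lemma tens_ext a b c (F G : Mx (a * b) -> Mx c) : is_linmap F -> is_linmap G ->
  (forall A B, F (kron A B) = G (kron A B)) -> forall X, F X = G X.
Proof.
move=> lF lG h X; rewrite (lin_delta lF) (lin_delta lG).
apply: eq_bigr => p _; apply: eq_bigr => q _; congr (_ *: _).
by case/mxvec_indexP: p => i j; case/mxvec_indexP: q => k l; rewrite -kron_delta.
Qed.

Lemma tens_ext3 a b c d (F G : Mx (a * b * c) -> Mx d) : is_linmap F -> is_linmap G ->
  (forall A B C, F (kron (kron A B) C) = G (kron (kron A B) C)) -> forall X, F X = G X.
Proof.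
move=> lF lG h; apply: tens_ext => // Y C; move: Y.
by apply: tens_ext => [||A B //]; apply: lin_comp => //; apply: kron_linl.
Qed.

Lemma tens_comp a1 a2 a3 b1 b2 b3 (f : Mx a2 -> Mx a3) (g : Mx b2 -> Mx b3)
    (f' : Mx a1 -> Mx a2) (g' : Mx b1 -> Mx b2) :
  is_linmap f -> is_linmap g -> is_linmap f' -> is_linmap g' ->
  forall X, tensmap (fun X => f (f' X)) (fun X => g (g' X)) X =
            tensmap f g (tensmap f' g' X).
Proof.
move=> lf lg lf' lg'; apply: tens_ext; first exact: lin_tens.
  by apply: lin_comp; apply: lin_tens.
by move=> A B; rewrite !tens_kron //; apply: lin_comp.
Qed.

Lemma eq_tens a1 a2 b1 b2 (f f' : Mx a1 -> Mx a2) (g g' : Mx b1 -> Mx b2) :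
  f =1 f' -> g =1 g' -> tensmap f g =1 tensmap f' g'.
Proof. by move=> ef eg X; rewrite /tensmap; do 4! apply: eq_bigr => ? _; rewrite ef eg. Qed.

Lemma tens_id a b X : tensmap (@id (Mx a)) (@id (Mx b)) X = X.
Proof.
move: X; apply: tens_ext; [exact: lin_tens | exact: lin_id |].
by move=> A B; rewrite tens_kron.
Qed.

Lemma tens_zerol a1 a2 b1 b2 (g : Mx b1 -> Mx b2) X :
  tensmap (fun _ : Mx a1 => 0 : Mx a2) g X = 0.
Proof.
rewrite /tensmap; do 4! apply: big1 => ? _.
by rewrite (lin0 (@kron_linl _ _ _)) scaler0.
Qed.

Lemma tens_zeror a1 a2 b1 b2 (f : Mx a1 -> Mx a2) X :
  tensmap f (fun _ : Mx b1 => 0 : Mx b2) X = 0.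
Proof.
rewrite /tensmap; do 4! apply: big1 => ? _.
by rewrite (lin0 (@kron_linr _ _ _)) scaler0.
Qed.

(** * Completely positive maps and channels *)

(** A single Kraus operator: an ancilla turns conjugation by [A] into conjugation by
    [kron A 1%:M]. *)
Lemma cp_conj a b (A : 'M[cpx]_(b, a)) : is_CP (fun X => A *m X *m adj A).
Proof.
move=> k _ X hX.
suff -> : tensI (fun X => A *m X *m adj A) k X = kron A 1%:M *m X *m adj (kron A 1%:M).
  exact: psd_conj.
move: X {hX}; apply: tens_ext; [exact: lin_tens | exact: lin_conj |].
move=> B C; rewrite /tensI tens_kron; [|exact: lin_conj|exact: lin_id].
rewrite adj_kron !kronM mul1mx; congr (kron _ _).
by rewrite adjE map_mx1 trmx1 mulmx1.
Qed.

Lemma cp_sum a b (I : Type) (s : seq I) (f : I -> Mx a -> Mx b) :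
  (forall i, is_linmap (f i)) -> (forall i, is_CP (f i)) ->
  is_CP (fun X => \sum_(i <- s) f i X).
Proof.
move=> lf cf k k0 X hX.
suff -> : tensI (fun X => \sum_(i <- s) f i X) k X = \sum_(i <- s) tensI (f i) k X.
  by apply: psd_sum => i; apply: cf.
move: X {hX}; apply: tens_ext; first exact: lin_tens.
  by apply: lin_bigsum => i; apply: lin_tens.
move=> B C; rewrite /tensI tens_kron; [|exact: lin_bigsum|exact: lin_id].
rewrite (lin_sum (@kron_linl _ _ C)); apply: eq_bigr => i _.
by rewrite /tensI tens_kron //; exact: lin_id.
Qed.

Lemma eq_CP a b (f g : Mx a -> Mx b) : f =1 g -> is_CP f -> is_CP g.
Proof. by move=> /functional_extensionality ->. Qed.

Lemma lin_prepare a b (M : Mx a) (rho : Mx b) : is_linmap (fun X => \tr (X *m M) *: rho).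
Proof.
by apply: lin_scaled => c X Y; rewrite mulmxDl -scalemxAl mxtraceD mxtraceZ.
Qed.

(* The Kraus operators are the [w *m adj v], from Cholesky factors [v] of [M]
   and [w] of [rho]. *)
Lemma cp_prepare a b (M : Mx a) (rho : Mx b) : psd M -> psd rho ->
  is_CP (fun X => \tr (X *m M) *: rho).
Proof.
move=> /psd_cholesky[s ->] /psd_cholesky[r ->].
apply: (@eq_CP _ _ (fun X => \sum_(v <- s) \sum_(w <- r)
          (w *m adj v) *m X *m adj (w *m adj v))).
  move=> X; rewrite mulmx_sumr.
  have -> : \tr (\sum_(v <- s) X *m (v *m adj v)) = \sum_(v <- s) \tr (X *m (v *m adj v)).
    by elim/big_rec2: _ => [|v y z _ <-]; rewrite ?mxtrace0 ?mxtraceD.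
  rewrite scaler_suml; apply: eq_bigr => v _.
  rewrite scaler_sumr; apply: eq_bigr => w _.
  rewrite mulmxA mxtrace_mulC mulmxA /mxtrace big_ord1.
  have -> : w *m adj v *m X *m adj (w *m adj v) = w *m (adj v *m X *m v) *m adj w.
    by rewrite adjM adjK !mulmxA.
  by rewrite [adj v *m X *m v]mx11_scalar mul_mx_scalar -scalemxAl !ord1 ?mxE ?mulr1n.
by apply: cp_sum => v; [apply: lin_bigsum => w; apply: lin_conj |
  apply: cp_sum => w; [apply: lin_conj | apply: cp_conj]].
Qed.

(** Reindexing is conjugation by a 0-1 matrix, hence a single Kraus operator; swaps, associators and
    unitors get their complete positivity from this. *)
Lemma mxsub_conj a b (s : 'I_b -> 'I_a) (X : Mx a) :
  mxsub s s X = rowsub s 1%:M *m X *m adj (rowsub s 1%:M).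
Proof.
apply/matrixP=> i j; rewrite mxE -rowsubE mxE (bigD1 (s j)) //= big1 => [|k kj].
  by rewrite !mxE eqxx rmorph1 mulr1 addr0.
by rewrite !mxE eq_sym (negPf kj) rmorph0 mulr0.
Qed.

Lemma psd_mxsub a b (s : 'I_b -> 'I_a) X : psd X -> psd (mxsub s s X).
Proof. by move=> hX; rewrite mxsub_conj; apply: psd_conj. Qed.

Lemma ch_mxsub a b (s : 'I_b -> 'I_a) t : cancel s t -> cancel t s ->
  is_channel (mxsub s s : Mx a -> Mx b).
Proof.
move=> st ts; split; first exact: lin_mxsub.
  by apply: (eq_CP (fun X => esym (mxsub_conj s X))); apply: cp_conj.
move=> X; rewrite /mxtrace [RHS](reindex s); last by exists t => ? _.
by apply: eq_bigr => i _; rewrite mxE.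
Qed.

(** * Structural isomorphisms of the tensor product *)

Definition swapmx a b : Mx (a * b) -> Mx (b * a) :=
  let s k := mxvec_index (idx k).2 (idx k).1 in mxsub s s.

Definition assocmx a b c : Mx (a * b * c) -> Mx (a * (b * c)) :=
  let s k := mxvec_index (mxvec_index (idx k).1 (idx (idx k).2).1) (idx (idx k).2).2 in
  mxsub s s.

Definition assocVmx a b c : Mx (a * (b * c)) -> Mx (a * b * c) :=
  let s k := mxvec_index (idx (idx k).1).1 (mxvec_index (idx (idx k).1).2 (idx k).2) in
  mxsub s s.

Definition runit a : Mx (a * 1) -> Mx a :=
  let s i := mxvec_index i (ord0 : 'I_1) in mxsub s s.

Definition runitV a : Mx a -> Mx (a * 1) := mxsub (fst \o @idx a 1) (fst \o @idx a 1).

Lemma swap_kron a b (A : Mx a) (B : Mx b) : swapmx (kron A B) = kron B A.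
Proof. by apply: mxvec_matrixP => i j k l; rewrite mxE !idx_mxvec !kronE mulrC. Qed.

Lemma assoc_kron a b c (A : Mx a) (B : Mx b) (C : Mx c) :
  assocmx (kron (kron A B) C) = kron A (kron B C).
Proof.
apply: mxvec_matrixP => i j k l; rewrite mxE !idx_mxvec !kronE /= -mulrA.
by congr (_ * _); rewrite mxE.
Qed.

Lemma assocV_kron a b c (A : Mx a) (B : Mx b) (C : Mx c) :
  assocVmx (kron A (kron B C)) = kron (kron A B) C.
Proof.
apply: mxvec_matrixP => i j k l; rewrite mxE !idx_mxvec !kronE /= mulrA.
by congr (_ * _); rewrite mxE.
Qed.

Lemma runit_kron a (A : Mx a) (B : Mx 1) : runit (kron A B) = B ord0 ord0 *: A.
Proof. by apply/matrixP=> i j; rewrite mxE kronE mxE mulrC. Qed.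

Lemma runitVE a (A : Mx a) : runitV A = kron A 1%:M.
Proof.
by apply: mxvec_matrixP => i j k l; rewrite kronE mxE /= !idx_mxvec !ord1 !mxE mulr1.
Qed.

Lemma runitK a (A : Mx a) : runit (runitV A) = A.
Proof. by rewrite runitVE runit_kron mxE eqxx scale1r. Qed.

Lemma ch_swap a b : is_channel (@swapmx a b).
Proof.
by apply: (@ch_mxsub _ _ _ (fun k => mxvec_index (idx k).2 (idx k).1)) => k;
  rewrite !idx_mxvec mxvec_idx.
Qed.

Lemma ch_assoc a b c : is_channel (@assocmx a b c).
Proof.
apply: (@ch_mxsub _ _ _ (fun k =>
  mxvec_index (idx (idx k).1).1 (mxvec_index (idx (idx k).1).2 (idx k).2))) => k;
  by rewrite !(idx_mxvec, mxvec_idx).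
Qed.

Lemma ch_runit a : is_channel (@runit a).
Proof.
apply: (@ch_mxsub _ _ _ (fun k => (idx k).1)) => k; first by rewrite idx_mxvec.
by rewrite -[RHS]mxvec_idx; congr mxvec_index; rewrite ord1 [RHS]ord1.
Qed.

Lemma ch_runitV a : is_channel (@runitV a).
Proof.
apply: (@ch_mxsub _ _ _ (fun i => mxvec_index i ord0)) => k; last by rewrite /= idx_mxvec.
by rewrite -[RHS]mxvec_idx; congr mxvec_index; rewrite ord1 [RHS]ord1.
Qed.

Lemma ch_lin a b (f : Mx a -> Mx b) : is_channel f -> is_linmap f.
Proof. by case. Qed.

Lemma ch_id a : is_channel (@id (Mx a)).
Proof. by split=> // k k0 X; rewrite /tensI tens_id. Qed.

Lemma cp_comp a b c (f : Mx b -> Mx c) (g : Mx a -> Mx b) :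
  is_linmap f -> is_linmap g -> is_CP f -> is_CP g -> is_CP (fun X => f (g X)).
Proof.
move=> lf lg cf cg k k0 X hX; rewrite /tensI.
rewrite (tens_comp lf (@lin_id k) lg (@lin_id k)).
by apply: cf => //; apply: cg.
Qed.

Lemma ch_comp a b c (f : Mx b -> Mx c) (g : Mx a -> Mx b) :
  is_channel f -> is_channel g -> is_channel (fun X => f (g X)).
Proof.
move=> [lf cf tf] [lg cg tg]; split; [exact: lin_comp | exact: cp_comp |].
by move=> X; rewrite tf tg.
Qed.

(** Reassociation merges the ancilla [b] with the further one [k] into a single ancilla of dimension
    [b * k]. *)
Lemma cp_tensI a1 a2 b (f : Mx a1 -> Mx a2) : (0 < b)%N -> is_linmap f -> is_CP f ->
  is_CP (tensI f b).
Proof.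
move=> b0 lf cf k k0 X hX.
suff -> : tensI (tensI f b) k X = assocVmx (tensI f (b * k) (assocmx X)).
  by apply: psd_mxsub; apply: cf; [rewrite muln_gt0 b0 | apply: psd_mxsub].
move: X {hX}; apply: tens_ext3; first exact: lin_tens.
  apply: lin_comp; first exact: lin_mxsub.
  by apply: lin_comp; [exact: lin_tens | exact: lin_mxsub].
move=> A B C; rewrite assoc_kron [in LHS]/tensI tens_kron; [|exact: lin_tens|exact: lin_id].
by rewrite /tensI !tens_kron ?assocV_kron //; exact: lin_id.
Qed.

(** The factor [c] covers two cases: 1 for a product of channels, 0 when one factor is a tangent. *)
Lemma tp_tens a1 a2 b1 b2 (f : Mx a1 -> Mx a2) (g : Mx b1 -> Mx b2) (c : cpx) :
  is_linmap f -> is_linmap g -> (forall A B, \tr (f A) * \tr (g B) = c * (\tr A * \tr B)) ->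
  forall X, \tr (tensmap f g X) = c * \tr X.
Proof.
move=> lf lg h X.
(* Traces are placed in 1 by 1 matrices so that [tens_ext], which compares matrix-valued maps,
   applies. *)
have : \tr (tensmap f g X) *: (1%:M : Mx 1) = (c * \tr X) *: 1%:M.
  move: X; apply: tens_ext => [||A B].
  - by apply: lin_scaled => s X Y; rewrite lin_tens mxtraceD mxtraceZ.
  - by apply: lin_scaled => s X Y; rewrite mxtraceD mxtraceZ mulrDr mulrCA.
  - by rewrite tens_kron // !mxtrace_kron h.
by move/matrixP/(_ ord0 ord0); rewrite !mxE !mulr1.
Qed.

(** [is_CP] attaches ancillas on the right only. The product is therefore factored as swap, [g] with
    ancilla [a1], swap back, [f] with ancilla [b2]. *)
Lemma ch_tens a1 a2 b1 b2 (f : Mx a1 -> Mx a2) (g : Mx b1 -> Mx b2) :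
  (0 < a1)%N -> (0 < b2)%N -> is_channel f -> is_channel g -> is_channel (tensmap f g).
Proof.
move=> a10 b20 [lf cf tf] [lg cg tg].
split; first exact: lin_tens; last first.
  by move=> X; rewrite (tp_tens (c := 1) lf lg) ?mul1r // => A B; rewrite tf tg mul1r.
apply: (@eq_CP _ _ (fun X => tensI f b2 (swapmx (tensI g a1 (swapmx X))))).
  apply: tens_ext; last first.
  - by move=> A B; rewrite swap_kron /tensI !tens_kron ?swap_kron ?tens_kron //; exact: lin_id.
  - exact: lin_tens.
  - apply: lin_comp; first exact: lin_tens.
    apply: lin_comp; first exact: lin_mxsub.
    by apply: lin_comp; [exact: lin_tens | exact: lin_mxsub].
have [lsw csw _] := ch_swap a1 b1; have [lsw' csw' _] := ch_swap b2 a1.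
have lfI : is_linmap (tensI f b2) by apply: lin_tens.
have lgI : is_linmap (tensI g a1) by apply: lin_tens.
apply: (@cp_comp _ _ _ (tensI f b2)) => //; [|exact: cp_tensI|].
  by apply: lin_comp => //; apply: lin_comp.
apply: (@cp_comp _ _ _ (@swapmx b2 a1)) => //; first by apply: lin_comp.
by apply: cp_comp => //; exact: cp_tensI.
Qed.

(** Complete positivity with the trivial ancilla of dimension 1, attached by [runitV] and removed by
    [runit]. *)
Lemma ch_psd a b (f : Mx a -> Mx b) X : is_channel f -> psd X -> psd (f X).
Proof.
move=> [lf cf _] hX.
suff -> : f X = runit (tensI f 1 (runitV X)).
  by apply: psd_mxsub; apply: cf => //; apply: psd_mxsub.
rewrite runitVE /tensI tens_kron ?runit_kron ?mxE ?eqxx ?scale1r //.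
Qed.

(* [X = H + i K] with [H] and [K] Hermitian *)
Lemma herm_adj a b (f : Mx a -> Mx b) : is_linmap f ->
  (forall X, hermitian X -> hermitian (f X)) -> forall X, f (adj X) = adj (f X).
Proof.
move=> lf hf X.
have h1 : hermitian (X + adj X) by rewrite /hermitian adjD adjK addrC.
have h2 : hermitian (Cpx rzero rone *: (X - adj X)).
  apply/matrixP=> i j; rewrite !mxE; move: (X i j) (X j i) => x y; cpx_ring.
have e1 : adj (f X + f (adj X)) = f X + f (adj X) by rewrite -(linD lf); apply: hf.
have e2 : adj (Cpx rzero rone *: (f X - f (adj X))) = Cpx rzero rone *: (f X - f (adj X)).
  suff -> : Cpx rzero rone *: (f X - f (adj X)) = f (Cpx rzero rone *: (X - adj X)) by apply: hf.
  by rewrite (linZ lf) (linD lf) -[- adj X]scaleN1r (linZ lf) scaleN1r.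
apply/matrixP=> i j; move/matrixP/(_ i j): e1; move/matrixP/(_ i j): e2.
rewrite !mxE; move: (f X i j) (f X j i) (f (adj X) i j) (f (adj X) j i) => x y z w e2 e1.
have := congr1 Re e1; have := congr1 Im e1; have := congr1 Re e2; have := congr1 Im e2.
by rewrite !cpxE /= => *; apply: cpx_ext; rewrite !cpxE; lra.
Qed.

(** Positivity makes the images of the rank-one matrices (e_i + c e_j)(e_i + c e_j)^* Hermitian. The
    choices c = 1 and c = i polarize this to [hd], which extends to all Hermitian matrices by
    linearity. *)
Lemma ch_herm a b (f : Mx a -> Mx b) X : is_channel f -> hermitian X -> hermitian (f X).
Proof.
move=> cf hX; have lf := ch_lin cf.
have hd i j : f (delta_mx j i) = adj (f (delta_mx i j)).
  have hv c : hermitian (f (delta_mx i i + cpx_conj c *: delta_mx i j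
                  + (c *: delta_mx j i + (c * cpx_conj c) *: delta_mx j j))).
    apply: psd_herm; apply: ch_psd => //.
    suff -> : delta_mx i i + cpx_conj c *: delta_mx i j
                  + (c *: delta_mx j i + (c * cpx_conj c) *: delta_mx j j)
      = (delta_mx i ord0 + c *: delta_mx j ord0) *m
        adj (delta_mx i (ord0 : 'I_1) + c *: delta_mx j ord0).
      exact: psd_outer.
    rewrite adjD adjZ !adj_delta mulmxDl !mulmxDr -!scalemxAl -!scalemxAr !mul_delta_mx.
    by rewrite scalerA.
  have hp k : hermitian (f (delta_mx k k)).
    apply: psd_herm; apply: ch_psd => //.
    by have := psd_outer (delta_mx k (ord0 : 'I_1)); rewrite adj_delta mul_delta_mx.
  have := hv 1; have := hv (Cpx rzero rone); have := hp i; have := hp j.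
  rewrite !(linD lf) !(linZ lf).
  move=> /matrixP hj /matrixP hi /matrixP h2 /matrixP h1; apply/matrixP=> k l.
  move: (hj k l) (hi k l) (h2 k l) (h1 k l); rewrite !mxE.
  set x1 := f _ k l; set x2 := f _ l k; set x3 := f _ k l; set x4 := f _ l k.
  set x5 := f _ k l; set x6 := f _ l k; set x7 := f _ k l; set x8 := f _ l k.
  move: x1 x2 x3 x4 x5 x6 x7 x8 => x1 x2 x3 x4 x5 x6 x7 x8 <- <- e2 e1.
  have := congr1 Re e1; have := congr1 Im e1; have := congr1 Re e2; have := congr1 Im e2.
  by rewrite !cpxE /= => *; apply: cpx_ext; rewrite !cpxE; lra.
rewrite /hermitian -[in RHS]hX (lin_delta lf X) (lin_delta lf (adj X)) adj_sum.
rewrite [RHS]exchange_big; apply: eq_bigr => i _; rewrite adj_sum; apply: eq_bigr => j _.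
by rewrite adjZ -hd mxE.
Qed.

Lemma ch_adj a b (f : Mx a -> Mx b) X : is_channel f -> f (adj X) = adj (f X).
Proof. by move=> hf; apply: herm_adj => [|Y]; [apply: ch_lin | apply: ch_herm]. Qed.

Lemma tens_adj a1 a2 b1 b2 (f : Mx a1 -> Mx a2) (g : Mx b1 -> Mx b2) X :
  is_linmap f -> is_linmap g -> (forall A, f (adj A) = adj (f A)) ->
  (forall B, g (adj B) = adj (g B)) -> tensmap f g (adj X) = adj (tensmap f g X).
Proof.
(* Taking adjoints on both sides makes the left side linear in [X]; [tensmap f g (adj X)] alone is
   antilinear and out of reach of [tens_ext]. *)
move=> lf lg hf hg; apply: (can_inj (@adjK _ _)); rewrite adjK.
move: X; apply: (@tens_ext _ _ _ (fun X => adj (tensmap f g (adj X)))).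
- by move=> c X Y; rewrite adjD adjZ lin_tens adjD adjZ conjK.
- exact: lin_tens.
- by move=> A B; rewrite adj_kron !tens_kron // hf hg adj_kron !adjK.
Qed.

(** * Tangent vectors under composition and tensor products *)

Section Tangents.
Variables (a b : nat).
Implicit Types (D : Mx a -> Mx b).

Lemma tan_adj D X : is_tangent D -> D (adj X) = adj (D X).
Proof. by case=> lD hD _; apply: herm_adj. Qed.

Lemma tan_zero : is_tangent (fun _ : Mx a => 0 : Mx b).
Proof.
split=> [|X _|X]; [exact: lin_zero| |by rewrite mxtrace0].
by apply/matrixP=> i j; rewrite !mxE rmorph0.
Qed.

Lemma tan_add D E : is_tangent D -> is_tangent E -> is_tangent (fun X => D X + E X).
Proof.
move=> [lD hD tD] [lE hE tE]; split=> [|X hX|X]; first exact: lin_add.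
  by rewrite /hermitian adjD hD ?hE.
by rewrite mxtraceD tD tE addr0.
Qed.

Lemma tan_rscale t D : is_tangent D -> is_tangent (rscale t D).
Proof.
move=> [lD hD tD]; split=> [|X hX|X]; first exact: lin_rscale.
  by rewrite /hermitian adjZ hD //; congr (_ *: _); cpx_ring.
by rewrite mxtraceZ tD mulr0.
Qed.

Lemma tan_pre a0 D (f : Mx a0 -> Mx a) :
  is_tangent D -> is_channel f -> is_tangent (fun X => D (f X)).
Proof.
move=> [lD hD tD] hf; split=> [|X hX|X //]; first exact: lin_comp lD (ch_lin hf).
by apply: hD; apply: ch_herm.
Qed.

Lemma tan_post b' D (f : Mx b -> Mx b') :
  is_tangent D -> is_channel f -> is_tangent (fun X => f (D X)).
Proof.
move=> [lD hD tD] hf; split=> [|X hX|X]; first exact: lin_comp (ch_lin hf) lD.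
  by apply: ch_herm => //; apply: hD.
by case: hf => _ _ ->.
Qed.

Lemma tan_tensl a' b' D (f : Mx a' -> Mx b') :
  is_tangent D -> is_channel f -> is_tangent (tensmap D f).
Proof.
move=> hD hf; case: (hD) (hf) => lD _ tD [lf _ _].
split=> [|X hX|X]; first exact: lin_tens.
  rewrite /hermitian -tens_adj ?hX // => Y; [exact: tan_adj|exact: ch_adj].
by rewrite (tp_tens (c := 0)) ?mul0r // => A B; rewrite tD !mul0r.
Qed.

Lemma tan_tensr a' b' D (f : Mx a' -> Mx b') :
  is_tangent D -> is_channel f -> is_tangent (tensmap f D).
Proof.
move=> hD hf; case: (hD) (hf) => lD _ tD [lf _ _].
split=> [|X hX|X]; first exact: lin_tens.
  rewrite /hermitian -tens_adj ?hX // => Y; [exact: ch_adj|exact: tan_adj].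
by rewrite (tp_tens (c := 0)) ?mul0r // => A B; rewrite tD mulr0 mul0r.
Qed.
End Tangents.

Lemma tens_add_l a1 a2 b1 b2 (f f' : Mx a1 -> Mx a2) (g : Mx b1 -> Mx b2) X :
  tensmap (fun Y => f Y + f' Y) g X = tensmap f g X + tensmap f' g X.
Proof.
rewrite /tensmap -big_split; apply: eq_bigr => i _; rewrite -big_split.
apply: eq_bigr => j _; rewrite -big_split; apply: eq_bigr => k _; rewrite -big_split.
by apply: eq_bigr => l _; rewrite /= (linD (@kron_linl _ _ _)) scalerDr.
Qed.

Lemma tens_add_r a1 a2 b1 b2 (f : Mx a1 -> Mx a2) (g g' : Mx b1 -> Mx b2) X :
  tensmap f (fun Y => g Y + g' Y) X = tensmap f g X + tensmap f g' X.
Proof.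
rewrite /tensmap -big_split; apply: eq_bigr => i _; rewrite -big_split.
apply: eq_bigr => j _; rewrite -big_split; apply: eq_bigr => k _; rewrite -big_split.
by apply: eq_bigr => l _; rewrite /= (linD (@kron_linr _ _ _)) scalerDr.
Qed.

Lemma tens_rscale_l a1 a2 b1 b2 t (f : Mx a1 -> Mx a2) (g : Mx b1 -> Mx b2) X :
  tensmap (rscale t f) g X = rC t *: tensmap f g X.
Proof.
rewrite /tensmap scaler_sumr; apply: eq_bigr => i _; rewrite scaler_sumr.
apply: eq_bigr => j _; rewrite scaler_sumr; apply: eq_bigr => k _; rewrite scaler_sumr.
by apply: eq_bigr => l _; rewrite (linZ (@kron_linl _ _ _)) !scalerA mulrC.
Qed.

Lemma tens_rscale_r a1 a2 b1 b2 t (f : Mx a1 -> Mx a2) (g : Mx b1 -> Mx b2) X :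
  tensmap f (rscale t g) X = rC t *: tensmap f g X.
Proof.
rewrite /tensmap scaler_sumr; apply: eq_bigr => i _; rewrite scaler_sumr.
apply: eq_bigr => j _; rewrite scaler_sumr; apply: eq_bigr => k _; rewrite scaler_sumr.
by apply: eq_bigr => l _; rewrite (linZ (@kron_linr _ _ _)) !scalerA mulrC.
Qed.

(** * States, the trace and measurements as channels *)

Lemma tr1 (X : Mx 1) : \tr X = X ord0 ord0.
Proof. by rewrite /mxtrace big_ord1 ord1. Qed.

Lemma ch_state n (rho : Mx n) : is_state rho ->
  is_channel (fun X : Mx 1 => X ord0 ord0 *: rho).
Proof.
move=> [hp ht]; have e (X : Mx 1) : X ord0 ord0 = \tr (X *m 1%:M) by rewrite mulmx1 tr1.
split.
- by apply: lin_scaled => c X Y; rewrite !mxE.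
- apply: (@eq_CP _ _ (fun X : Mx 1 => \tr (X *m 1%:M) *: rho)) => [X|]; first by rewrite e.
  by apply: cp_prepare => //; apply: psd_scalar1.
- by move=> X; rewrite mxtraceZ ht mulr1 tr1.
Qed.

Lemma ch_trace n : is_channel (fun X : Mx n => \tr X *: (1%:M : Mx 1)).
Proof.
split.
- by apply: lin_scaled => c X Y; rewrite mxtraceD mxtraceZ.
- apply: (@eq_CP _ _ (fun X : Mx n => \tr (X *m 1%:M) *: 1%:M)) => [X|]; first by rewrite mulmx1.
  by apply: cp_prepare; apply: psd_scalar1.
- by move=> X; rewrite mxtraceZ mxtrace1 mulr1.
Qed.

(** A sum of measure-and-prepare maps, one for each outcome, preparing the basis state of that
    outcome. *)
Lemma ch_povm n m (M : 'I_m -> Mx n) : is_povm M ->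
  is_channel (fun X => diag_mx (\row_y \tr (X *m M y))).
Proof.
move=> [hM sM].
have e X : diag_mx (\row_y \tr (X *m M y)) =
           \sum_y \tr (X *m M y) *: delta_mx y y :> Mx m.
  apply/matrixP=> i j; rewrite summxE !mxE (bigD1 i) //= big1 => [|k ki].
    by rewrite !mxE eqxx addr0 eq_sym; case: eqP => _; rewrite /= ?mulr1 ?mulr0.
  by rewrite !mxE eq_sym (negPf ki) mulr0.
split.
- move=> c X Y; rewrite !e.
  by rewrite (lin_bigsum _ (fun y => lin_prepare (M y) (delta_mx y y : Mx m))).
- apply: (eq_CP (fun X => esym (e X))); apply: cp_sum => y; first exact: lin_prepare.
  apply: cp_prepare => //.
  by have := psd_outer (delta_mx y (ord0 : 'I_1)); rewrite adj_delta mul_delta_mx.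
- move=> X; rewrite mxtrace_diag -[in RHS](mulmx1 X) -sM mulmx_sumr raddf_sum.
  by apply: eq_bigr => y _; rewrite mxE.
Qed.

(** * The monoidal preorder of channel-tangent pairs *)

Record cpair := CPair {
  din : nat;
  dout : nat;
  chan : Mx din -> Mx dout;
  tang : Mx din -> Mx dout;
  din_gt0 : (0 < din)%N;
  dout_gt0 : (0 < dout)%N;
  chanP : is_channel chan;
  tangP : is_tangent tang
}.
Arguments chan : clear implicits.
Arguments tang : clear implicits.

Lemma chan_lin P : is_linmap (chan P). Proof. exact: ch_lin (chanP P). Qed.
Lemma tang_lin P : is_linmap (tang P). Proof. by case: (tangP P). Qed.

(** No side information passes from [pre] to [post]; where an ancilla is wanted it is made explicit
    by tensoring with an [idpair]. *)
Definition ple (P Q : cpair) : Prop :=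
  exists (pre : Mx (din P) -> Mx (din Q)) (post : Mx (dout Q) -> Mx (dout P)),
    [/\ is_channel pre, is_channel post,
        forall X, chan P X = post (chan Q (pre X)) &
        forall X, tang P X = post (tang Q (pre X))].
Local Infix "<~" := ple (at level 70).

(** Takes the place of equality of pairs: only the maps have to agree, pointwise, and the proof
    fields are arbitrary. *)
Lemma ple_eq a b (f D g E : Mx a -> Mx b) ha hb hf hD ha' hb' hg hE :
  f =1 g -> D =1 E ->
  @CPair a b f D ha hb hf hD <~ @CPair a b g E ha' hb' hg hE.
Proof. by move=> e1 e2; exists id, id; split=> //; exact: ch_id. Qed.

Lemma ple_refl P : P <~ P.
Proof. by exists id, id; split=> //; exact: ch_id. Qed.

Lemma ple_trans Q P S : P <~ Q -> Q <~ S -> P <~ S.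
Proof.
move=> [f [g [hf hg e1 e2]]] [f' [g' [hf' hg' e1' e2']]].
exists (fun X => f' (f X)), (fun X => g (g' X)); split; try exact: ch_comp.
  by move=> X; rewrite e1 e1'.
by move=> X; rewrite e2 e2'.
Qed.

Lemma tan_ptens P Q :
  is_tangent (fun X => tensmap (tang P) (chan Q) X + tensmap (chan P) (tang Q) X).
Proof.
by apply: tan_add; [apply: tan_tensl | apply: tan_tensr];
  try exact: tangP; exact: chanP.
Qed.

Lemma muln_pos m n : (0 < m)%N -> (0 < n)%N -> (0 < m * n)%N.
Proof. by rewrite muln_gt0 => -> ->. Qed.

Definition ptens P Q : cpair :=
  CPair (muln_pos (din_gt0 P) (din_gt0 Q)) (muln_pos (dout_gt0 P) (dout_gt0 Q))
        (ch_tens (din_gt0 P) (dout_gt0 Q) (chanP P) (chanP Q)) (tan_ptens P Q).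
Local Infix "\ox" := ptens (at level 40, left associativity).

Definition idpair k (k0 : (0 < k)%N) : cpair := CPair k0 k0 (ch_id k) (tan_zero k k).

Definition one_pair : cpair := @idpair 1 isT.

Definition smul t P : cpair :=
  CPair (din_gt0 P) (dout_gt0 P) (chanP P) (tan_rscale t (tangP P)).

Lemma tpow_gt0 d n : (0 < d)%N -> (0 < tpow d n)%N.
Proof. by move=> d0; elim: n => //= n IH; rewrite muln_gt0 IH. Qed.

Lemma ch_tpow P n : is_channel (tpowmap (chan P) n).
Proof.
elim: n => [|n IH] /=; first exact: ch_id.
by apply: ch_tens => //; [exact: tpow_gt0 (din_gt0 P) | exact: dout_gt0 | exact: chanP].
Qed.

Lemma tan_dpow P n : is_tangent (dpow (chan P) (tang P) n).
Proof.
elim: n => [|n IH] /=; first exact: tan_zero.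
apply: tan_add; first exact: tan_tensl IH (chanP P).
exact: tan_tensr (tangP P) (ch_tpow P n).
Qed.

Definition ppow P n : cpair :=
  CPair (tpow_gt0 n (din_gt0 P)) (tpow_gt0 n (dout_gt0 P)) (ch_tpow P n) (tan_dpow P n).

Lemma ple_tens P P' Q Q' : P <~ P' -> Q <~ Q' -> P \ox Q <~ P' \ox Q'.
Proof.
move=> [f [g [hf hg e1 e2]]] [f' [g' [hf' hg' e1' e2']]].
have := (ch_lin hf, ch_lin hg, ch_lin hf', ch_lin hg').
move=> [[[lf lg] lf'] lg'].
exists (tensmap f f'), (tensmap g g').
suff [] :
    (forall X, chan (P \ox Q) X = tensmap g g' (chan (P' \ox Q') (tensmap f f' X))) /\
    (forall X, tang (P \ox Q) X = tensmap g g' (tang (P' \ox Q') (tensmap f f' X))).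
  by split=> //; apply: ch_tens => //; (apply: din_gt0 || apply: dout_gt0).
have h h1 h2 : is_linmap h1 -> is_linmap h2 -> forall X,
      tensmap (fun Y => g (h1 (f Y))) (fun Y => g' (h2 (f' Y))) X =
      tensmap g g' (tensmap h1 h2 (tensmap f f' X)).
    move=> l1 l2 X.
    by rewrite (tens_comp lg lg' (lin_comp l1 lf) (lin_comp l2 lf')) (tens_comp l1 l2 lf lf').
  split=> X /=; first by rewrite (eq_tens e1 e1') h //; exact: chan_lin.
  rewrite (eq_tens e1 e2') (eq_tens e2 e1') (linD (@lin_tens _ _ _ _ g g')).
  by rewrite !h //; try exact: chan_lin; exact: tang_lin.
Qed.

Lemma ple_swap P Q : P \ox Q <~ Q \ox P.
Proof.
have lC := chan_lin; have lT := tang_lin.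
exists (@swapmx _ _), (@swapmx _ _); split; try exact: ch_swap; apply: tens_ext.
- exact: lin_tens.
- apply: lin_comp; first exact: lin_mxsub.
  by apply: lin_comp; [exact: lin_tens | exact: lin_mxsub].
- by move=> A B; rewrite swap_kron /= !tens_kron ?swap_kron.
- by apply: lin_add; exact: lin_tens.
- apply: lin_comp; first exact: lin_mxsub.
  by apply: lin_comp; [apply: lin_add; exact: lin_tens | exact: lin_mxsub].
- move=> A B; rewrite swap_kron /= !tens_kron // (linD (ch_lin (@ch_swap _ _))).
  by rewrite !swap_kron addrC.
Qed.

Lemma ch_assocV a b c : is_channel (@assocVmx a b c).
Proof.
apply: (@ch_mxsub _ _ _ (fun k =>
  mxvec_index (mxvec_index (idx k).1 (idx (idx k).2).1) (idx (idx k).2).2)) => k;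
  by rewrite !(idx_mxvec, mxvec_idx).
Qed.

Lemma ple_assoc P Q S : P \ox Q \ox S <~ P \ox (Q \ox S).
Proof.
have lC := chan_lin; have lT := tang_lin.
exists (@assocmx _ _ _), (@assocVmx _ _ _); split; try exact: ch_assoc;
  try exact: ch_assocV; apply: tens_ext3.
- exact: lin_tens.
- apply: lin_comp; first exact: lin_mxsub.
  by apply: lin_comp; [exact: lin_tens | exact: lin_mxsub].
- move=> A B C; rewrite assoc_kron /= !tens_kron ?assocV_kron //; exact: lin_tens.
- by apply: lin_add; exact: lin_tens.
- apply: lin_comp; first exact: lin_mxsub.
  by apply: lin_comp; [apply: lin_add; exact: lin_tens | exact: lin_mxsub].
- move=> A B C; rewrite assoc_kron /=.
  rewrite tens_add_l tens_add_r.
  rewrite !tens_kron //; try exact: lin_tens.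
  by rewrite !(linD (ch_lin (@ch_assocV _ _ _))) !assocV_kron addrA.
Qed.

(** The braiding reverses the associator: swaps and two uses of [ple_assoc] lead through Q (S P) and
    S (P Q) to (P Q) S. *)
Lemma ple_assocV P Q S : P \ox (Q \ox S) <~ P \ox Q \ox S.
Proof.
apply: ple_trans (ple_swap _ _) _; apply: ple_trans (ple_assoc _ _ _) _.
apply: ple_trans (ple_swap _ _) _; apply: ple_trans (ple_assoc _ _ _) _.
exact: ple_swap.
Qed.

Lemma mx11E (B : Mx 1) : B = B ord0 ord0 *: 1%:M.
Proof. by rewrite scalemx1; exact: mx11_scalar. Qed.

Lemma ple_unit P : P \ox one_pair <~ P.
Proof.
have lC := chan_lin; have lT := tang_lin.
exists (@runit _), (@runitV _); split; try exact: ch_runit; try exact: ch_runitV;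
  apply: tens_ext.
- exact: lin_tens.
- apply: lin_comp; first exact: lin_mxsub.
  by apply: lin_comp => //; exact: lin_mxsub.
- move=> A B; rewrite runit_kron runitVE /= tens_kron // (linZ (@lC _)).
  by rewrite (linZ (@kron_linl _ _ _)) -(linZ (@kron_linr _ _ (chan P A))) -mx11E.
- by apply: lin_add; exact: lin_tens.
- apply: lin_comp; first exact: lin_mxsub.
  by apply: lin_comp => //; exact: lin_mxsub.
- move=> A B; rewrite runit_kron runitVE /= tens_zeror addr0 tens_kron // (linZ (@lT _)).
  by rewrite (linZ (@kron_linl _ _ _)) -(linZ (@kron_linr _ _ (tang P A))) -mx11E.
Qed.

Lemma ple_unitV P : P <~ P \ox one_pair.
Proof.
have lC := chan_lin; have lT := tang_lin.
exists (@runitV _), (@runit _); split=> [||X|X]; [exact: ch_runitV | exact: ch_runit | |].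
- by rewrite runitVE /= tens_kron // runit_kron mxE eqxx scale1r.
- rewrite runitVE /= tens_zeror addr0 tens_kron // runit_kron mxE eqxx scale1r //.
Qed.

Lemma exists_state n : (0 < n)%N -> exists rho : Mx n, is_state rho.
Proof.
move=> n0; pose i := Ordinal n0; exists (delta_mx i i); split.
  by have := psd_outer (delta_mx i (ord0 : 'I_1)); rewrite adj_delta mul_delta_mx.
rewrite /mxtrace (bigD1 i) //= big1 => [|j ji]; first by rewrite mxE eqxx addr0.
by rewrite mxE (negPf ji).
Qed.

(** Prepare a fixed state, apply the channel, discard the output. Trace preservation leaves the
    identity of C, and tracelessness of the tangent leaves the zero tangent. *)
Lemma ple_one P : one_pair <~ P.
Proof.
have [rho hrho] := exists_state (din_gt0 P).
exists (fun X : Mx 1 => X ord0 ord0 *: rho), (fun X => \tr X *: (1%:M : Mx 1)).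
split=> /=; [exact: ch_state | exact: ch_trace | |] => X.
  have [_ _ ->] := chanP P; case: hrho => _ ht; rewrite mxtraceZ ht mulr1.
  exact: mx11E.
by have [_ _ ->] := tangP P; rewrite scale0r.
Qed.

(** Since the unit is least, extra factors only go up. This gives one half of (E) and the
    monotonicity in [n] that [fekete_sub] requires. *)
Lemma ple_tensr P Q : P <~ P \ox Q.
Proof.
by apply: ple_trans (ple_unitV P) _; apply: ple_tens; [exact: ple_refl | exact: ple_one].
Qed.

Lemma ple_tensACA P Q S T : (P \ox Q) \ox (S \ox T) <~ (P \ox S) \ox (Q \ox T).
Proof.
apply: ple_trans (ple_assoc _ _ _) _.
apply: (@ple_trans (P \ox (S \ox (Q \ox T)))); last exact: ple_assocV.
apply: ple_tens; first exact: ple_refl.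
apply: ple_trans (ple_assocV _ _ _) _.
apply: (@ple_trans ((S \ox Q) \ox T)); last exact: ple_assoc.
by apply: ple_tens; [exact: ple_swap | exact: ple_refl].
Qed.

Lemma ple_smul t P Q : P <~ Q -> smul t P <~ smul t Q.
Proof.
move=> [f [g [hf hg e1 e2]]]; exists f, g; split=> // X.
by rewrite /= /rscale e2 (linZ (ch_lin hg)).
Qed.

Lemma ple_smul_tens t P Q : smul t (P \ox Q) <~ smul t P \ox smul t Q.
Proof.
by apply: ple_eq => // X; rewrite tens_rscale_l tens_rscale_r -scalerDr.
Qed.

Lemma ple_tens_smul t P Q : smul t P \ox smul t Q <~ smul t (P \ox Q).
Proof.
by apply: ple_eq => // X; rewrite tens_rscale_l tens_rscale_r -scalerDr.
Qed.

Lemma ple_smulK t P : t <> rzero -> smul (/ t)%coqR (smul t P) <~ P.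
Proof.
move=> t0; case: P => a b f D ha hb hf hD; apply: ple_eq => // X.
by rewrite /= /rscale scalerA -rCM Rinv_l // scale1r.
Qed.

Lemma ple_smulKV t P : t <> rzero -> P <~ smul (/ t)%coqR (smul t P).
Proof.
move=> t0; case: P => a b f D ha hb hf hD; apply: ple_eq => // X.
by rewrite /= /rscale scalerA -rCM Rinv_l // scale1r.
Qed.

Lemma ple_smul_idpair t k (k0 : (0 < k)%N) : smul t (idpair k0) <~ idpair k0.
Proof. by apply: ple_eq => // X; rewrite /rscale scaler0. Qed.

Lemma ple_idpair_tens k l (k0 : (0 < k)%N) (l0 : (0 < l)%N) :
  idpair k0 \ox idpair l0 <~ idpair (muln_pos k0 l0).
Proof. by apply: ple_eq => X; rewrite ?tens_id // tens_zerol tens_zeror addr0. Qed.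

(** * Powers in the preorder *)

Lemma ple_powS P n : ppow P n.+1 <~ ppow P n \ox P.
Proof. exact: ple_eq. Qed.

Lemma ple_powSV P n : ppow P n \ox P <~ ppow P n.+1.
Proof. exact: ple_eq. Qed.

Lemma ple_pow0 P Q : ppow P 0 <~ Q.
Proof. by apply: ple_trans (ple_one Q); apply: ple_eq. Qed.

Lemma ple_powD P m n : ppow P (m + n) <~ ppow P m \ox ppow P n.
Proof.
elim: n => [|n IH]; first by rewrite addn0; exact: ple_tensr.
rewrite addnS; apply: ple_trans (ple_powS _ _) _.
apply: (@ple_trans (ppow P m \ox ppow P n \ox P)).
  by apply: ple_tens => //; exact: ple_refl.
apply: ple_trans (ple_assoc _ _ _) _.
by apply: ple_tens; [exact: ple_refl | exact: ple_powSV].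
Qed.

Lemma ple_powDV P m n : ppow P m \ox ppow P n <~ ppow P (m + n).
Proof.
elim: n => [|n IH].
  rewrite addn0; apply: (ple_trans _ (ple_unit _)).
  by apply: ple_tens; [exact: ple_refl | exact: ple_pow0].
rewrite addnS; apply: (ple_trans _ (ple_powSV _ _)).
apply: (@ple_trans (ppow P m \ox ppow P n \ox P)); last first.
  by apply: ple_tens => //; exact: ple_refl.
apply: (ple_trans _ (ple_assocV _ _ _)).
by apply: ple_tens; [exact: ple_refl | exact: ple_powS].
Qed.

Lemma ple_pow P Q n : P <~ Q -> ppow P n <~ ppow Q n.
Proof.
move=> h; elim: n => [|n IH]; first exact: ple_pow0.
apply: ple_trans (ple_powS _ _) _; apply: (ple_trans _ (ple_powSV _ _)).
exact: ple_tens.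
Qed.

Lemma ple_powM P n m : ppow (ppow P n) m <~ ppow P (m * n).
Proof.
elim: m => [|m IH]; first exact: ple_pow0.
apply: ple_trans (ple_powS _ _) _; rewrite mulSnr.
apply: (ple_trans _ (ple_powDV _ _ _)).
by apply: ple_tens => //; exact: ple_refl.
Qed.

Lemma ple_powMV P n m : ppow P (m * n) <~ ppow (ppow P n) m.
Proof.
elim: m => [|m IH]; first exact: ple_pow0.
apply: (ple_trans _ (ple_powSV _ _)); rewrite mulSnr.
apply: ple_trans (ple_powD _ _ _) _.
by apply: ple_tens => //; exact: ple_refl.
Qed.

Lemma ple_pow_tens P Q n : ppow (P \ox Q) n <~ ppow P n \ox ppow Q n.
Proof.
elim: n => [|n IH]; first exact: ple_pow0.
apply: ple_trans (ple_powS _ _) _.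
apply: (@ple_trans (ppow P n \ox ppow Q n \ox (P \ox Q))).
  by apply: ple_tens => //; exact: ple_refl.
apply: ple_trans (ple_tensACA _ _ _ _) _.
by apply: ple_tens; exact: ple_powSV.
Qed.

Lemma ple_pow_id k (k0 : (0 < k)%N) n : ppow (idpair k0) n <~ idpair (tpow_gt0 n k0).
Proof.
elim: n => [|n IH]; first exact: ple_pow0.
apply: ple_trans (ple_powS _ _) _.
apply: (@ple_trans (idpair (tpow_gt0 n k0) \ox idpair k0)).
  by apply: ple_tens => //; exact: ple_refl.
apply: ple_trans (ple_idpair_tens _ _) _; exact: ple_eq.
Qed.

Lemma ple_pow_smul t P n : ppow (smul t P) n <~ smul t (ppow P n).
Proof.
elim: n => [|n IH]; first exact: ple_pow0.
apply: ple_trans (ple_powS _ _) _.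
apply: (@ple_trans (smul t (ppow P n) \ox smul t P)).
  by apply: ple_tens => //; exact: ple_refl.
apply: ple_trans (ple_tens_smul _ _ _) _; apply: ple_smul; exact: ple_powSV.
Qed.

Lemma ple_smul_pow t P n : smul t (ppow P n) <~ ppow (smul t P) n.
Proof.
elim: n => [|n IH].
  by apply: ple_eq => // X; rewrite /rscale scaler0.
apply: (ple_trans _ (ple_powSV _ _)).
apply: ple_trans (ple_smul t (ple_powS P n)) _.
apply: ple_trans (ple_smul_tens _ _ _) _.
by apply: ple_tens => //; exact: ple_refl.
Qed.

(** * Extended nonnegative reals *)

Section Ereal.
Local Open Scope R_scope.

Definition eadd (x y : ereal) : ereal :=
  match x, y with EFin a, EFin b => EFin (a + b) | _, _ => EInf end.

Lemma ele_refl x : ele x x.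
Proof. by case: x => //= r; exact: Rle_refl. Qed.

Lemma ele_trans y x z : ele x y -> ele y z -> ele x z.
Proof. by case: x y z => [a|] [b|] [c|] //=; exact: Rle_trans. Qed.

Lemma ele_antisym x y : ele x y -> ele y x -> x = y.
Proof. by case: x y => [a|] [b|] //= h1 h2; congr EFin; exact: Rle_antisym. Qed.

Lemma escale_le c x y : 0 <= c -> ele x y -> ele (escale c x) (escale c y).
Proof.
case: x y => [a|] [b|] //= c0; try case: Req_EM_T => //= e; try lra.
- by move=> ?; apply: Rmult_le_compat_l.
- by move=> _; rewrite e Rmult_0_l; exact: Rle_refl.
Qed.

Lemma escale_comp c d x : escale c (escale d x) = escale (c * d) x.
Proof.
case: x => [a|] /=; first by rewrite Rmult_assoc.
case: (Req_EM_T d 0) => hd /=.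
  rewrite Rmult_0_r; case: Req_EM_T => // -[]; rewrite hd; exact: Rmult_0_r.
case: (Req_EM_T c 0) => hc; case: Req_EM_T => // h.
  by case: h; rewrite hc Rmult_0_l.
by case: (Rmult_integral _ _ h).
Qed.

Lemma escale1 x : escale 1 x = x.
Proof. by case: x => [a|] /=; [rewrite Rmult_1_l | case: Req_EM_T => // h; lra]. Qed.

Lemma escale0 x : escale 0 x = EFin 0.
Proof. by case: x => [a|] /=; [rewrite Rmult_0_l | case: Req_EM_T]. Qed.

Lemma escale_inf c : c <> 0 -> escale c EInf = EInf.
Proof. by rewrite /=; case: Req_EM_T. Qed.

Lemma escale_ge0 c x : 0 <= c -> ele (EFin 0) x -> ele (EFin 0) (escale c x).
Proof. by move=> c0 h; have := escale_le c0 h; rewrite /= Rmult_0_r. Qed.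

(** [ereal] contains all negative reals, so the empty set has no least upper bound; hence the
    nonemptiness. A set that is unbounded or contains [EInf] has supremum [EInf]. *)
Lemma esup_spec S : (exists x, S x) -> is_esup S (esup S).
Proof.
move=> [x0 Sx0]; apply: epsilon_spec.
have [hinf|hfin] := excluded_middle_informative (S EInf).
  by exists EInf; split=> [[]|u] //; apply.
have [[M hM]|hunb] := excluded_middle_informative (exists M, forall a, S (EFin a) -> a <= M).
  have [||L [L1 L2]] := completeness (fun a => S (EFin a)).
  - by exists M => a; exact: hM.
  - by case: x0 Sx0 => [a|] Sa; [exists a | case: hfin].
  exists (EFin L); split=> [[a|] Sa //|[b|] hb //=]; first exact: L1.
  by apply: L2 => a Sa; exact: (hb _ Sa).
exists EInf; split=> [[]|[b|] hb] //; case: hunb; exists b => a Sa.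
exact: (hb _ Sa).
Qed.

(** A set without finite elements, the empty set included, has infimum [EInf]. Otherwise the infimum
    is minus the supremum of the negated finite elements, which 0 bounds. *)
Lemma einf_spec S : (forall x, S x -> ele (EFin 0) x) -> is_einf S (einf S).
Proof.
move=> hS; apply: epsilon_spec.
have [[a0 Sa0]|hno] := excluded_middle_informative (exists a, S (EFin a)); last first.
  exists EInf; split=> [[a|] Sa //|[b|] hb //].
  by case: hno; exists a.
have [||L [L1 L2]] := completeness (fun a => S (EFin (- a))).
- by exists 0 => a Sa; have /= := hS _ Sa; lra.
- by exists (- a0); rewrite Ropp_involutive.
exists (EFin (- L)); split=> [[a|] Sa //=|[b|] hb /=].
- by have := L1 (- a); rewrite Ropp_involutive => /(_ Sa); lra.
- suff : L <= - b by lra.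
  by apply: L2 => a Sa; have /= := hb _ Sa; lra.
- exact: (hb _ Sa0).
Qed.

Lemma econv_le u v l l' N : econv u l -> econv v l' ->
  (forall n, (N <= n)%N -> ele (u n) (v n)) -> ele l l'.
Proof.
case: l l' => [a|] [b|] //= hu hv huv.
- apply: Rnot_lt_le => hlt.
  have [|N1 h1] := hu ((a - b) / 2); first lra.
  have [|N2 h2] := hv ((a - b) / 2); first lra.
  pose n := maxn N (maxn N1 N2).
  have [|x [ex hx]] := h1 n; first by rewrite !leq_max leqnn orbT.
  have [|y [ey hy]] := h2 n; first by rewrite !leq_max leqnn !orbT.
  have := huv n; rewrite leq_max leqnn ex ey => /(_ isT) /=.
  by move: hx hy; do 2![move/Rabs_def2; case => ? ?]; lra.
- have [|N2 h2] := hv 1; first lra.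
  have [N1 h1] := hu (b + 1).
  pose n := maxn N (maxn N1 N2).
  have [|y [ey hy]] := h2 n; first by rewrite !leq_max leqnn !orbT.
  have := huv n; rewrite leq_max leqnn ey => /(_ isT).
  have := h1 n; rewrite !leq_max leqnn orbT => /(_ isT).
  case: (u n) => //= x hx; move: hy => /Rabs_def2[? ?]; lra.
Qed.

Lemma elim_eq u l : econv u l -> elim u = l.
Proof.
move=> h; have h' : econv u (elim u) by apply: epsilon_spec; exists l.
by apply: ele_antisym; apply: (@econv_le u u _ _ 0) => // n _; exact: ele_refl.
Qed.

Lemma econv_ext u v l N : econv u l -> (forall n, (N <= n)%N -> u n = v n) -> econv v l.
Proof.
case: l => [a|] h e /=.
  move=> eps heps; have [N1 h1] := h eps heps; exists (maxn N N1) => n.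
  by rewrite geq_max => /andP[/e <- /h1].
move=> M; have [N1 h1] := h M; exists (maxn N N1) => n.
by rewrite geq_max => /andP[/e <- /h1].
Qed.

Lemma econv_const l : econv (fun _ => l) l.
Proof.
case: l => [a|] /=; last by exists 0%N.
by move=> eps heps; exists 0%N => n _; exists a; rewrite Rminus_diag Rabs_R0.
Qed.

Lemma econv_sub u l k : (0 < k)%N -> econv u l -> econv (fun n => u (n * k)%N) l.
Proof.
move=> k0; have hk N n : (N <= n)%N -> (N <= n * k)%N.
  by move=> h; rewrite (leq_trans h) // leq_pmulr.
case: l => [a|] h /=.
  by move=> eps heps; have [N hN] := h eps heps; exists N => n /hk/hN.
by move=> M; have [N hN] := h M; exists N => n /hk/hN.
Qed.

Lemma econv_scale c u l : 0 <= c -> econv u l -> econv (fun n => escale c (u n)) (escale c l).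
Proof.
move=> c0; case: (Req_EM_T c 0) => [->|hc] h.
  (* The convention 0 * oo = 0 makes both sides 0 here, even if [l] or some terms are infinite. *)
  by rewrite escale0; apply: (econv_ext (N := 0) (econv_const (EFin 0))) => n _; rewrite escale0.
have cpos : 0 < c by lra.
case: l h => [a|] h.
  move=> eps heps; have [|N hN] := h (eps / c); first exact: Rdiv_lt_0_compat.
  exists N => n /hN[x [-> hx]]; exists (c * x); split=> //=.
  rewrite -Rmult_minus_distr_l Rabs_mult (Rabs_pos_eq c) //.
  have e : c * (eps / c) = eps by field; lra.
  by rewrite -e; apply: Rmult_lt_compat_l.
rewrite escale_inf // => M; have [N hN] := h (M / c); exists N => n /hN.
case: (u n) => [x|]; rewrite ?escale_inf //= => hx.
have e : c * (M / c) = M by field; lra.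
by rewrite -e; apply: Rmult_le_compat_l.
Qed.

(** * Fekete's lemma *)

Lemma INR_gt0 n : (0 < n)%N -> 0 < INR n.
Proof. by move=> /ltP n0; exact: lt_0_INR. Qed.

Lemma divn_INR m n : (0 < m)%N ->
  INR (n %/ m) * INR m <= INR n /\ INR n <= (INR (n %/ m) + 1) * INR m.
Proof.
move=> m0; rewrite -S_INR -!mult_INR; split; apply: le_INR; apply/leP.
  exact: leq_divM.
by rewrite ltnW // ltn_ceil.
Qed.

(** Write n = q m + s with s < m. Then r n >= q r m and q >= n / m - 1. The explicit error
    [r m / INR n] vanishes for fixed [m]. *)
Lemma superadd_quot (r : nat -> R) : (forall n, 0 <= r n) ->
  (forall m n, r m + r n <= r (m + n)%N) ->
  forall m n, (0 < m)%N -> (0 < n)%N -> r m / INR m - r m / INR n <= r n / INR n.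
Proof.
move=> r0 hr m n m0 n0.
have hq q : INR q * r m <= r (q * m)%N.
  elim: q => [|q IH]; first by rewrite Rmult_0_l; exact: r0.
  by rewrite S_INR mulSnr; have := hr (q * m)%N m; lra.
have h1 : INR (n %/ m) * r m <= r n.
  by rewrite {2}(divn_eq n m); have := hr (n %/ m * m)%N (n %% m)%N;
     have := r0 (n %% m)%N; have := hq (n %/ m)%N; lra.
have [_ h2] := divn_INR n m0; have mp := INR_gt0 m0; have np := INR_gt0 n0.
have h3 : INR n * (r m / INR m) <= (INR (n %/ m) + 1) * r m.
  have -> : (INR (n %/ m) + 1) * r m = (INR (n %/ m) + 1) * INR m * (r m / INR m).
    by field; lra.
  by apply: Rmult_le_compat_r => //; apply: Rle_mult_inv_pos.
apply: (Rmult_le_reg_l (INR n)) => //.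
have -> : INR n * (r n / INR n) = r n by field; lra.
have -> : INR n * (r m / INR m - r m / INR n) = INR n * (r m / INR m) - r m by field; lra.
lra.
Qed.

(** Monotonicity allows rounding [n] up to a multiple (q + 1) m, so that no bound on the values at
    remainders is called for. *)
Lemma subadd_quot (r : nat -> R) : (forall n, 0 <= r n) ->
  (forall m n, r m <= r (m + n)%N) -> (forall m n, r (m + n)%N <= r m + r n) ->
  forall m n, (0 < m)%N -> (0 < n)%N -> r n / INR n <= r m / INR m + r m / INR n.
Proof.
move=> r0 hmon hr m n m0 n0.
have hq q : r (q.+1 * m)%N <= INR q.+1 * r m.
  elim: q => [|q IH]; first by rewrite mul1n /= Rmult_1_l; exact: Rle_refl.
  rewrite S_INR mulSnr; have := hr (q.+1 * m)%N m; lra.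
have h1 : r n <= (INR (n %/ m) + 1) * r m.
  have /subnKC e : (n <= (n %/ m).+1 * m)%N by rewrite ltnW // ltn_ceil.
  have := hmon n ((n %/ m).+1 * m - n)%N; rewrite e -S_INR.
  by have := hq (n %/ m)%N; lra.
have [h2 _] := divn_INR n m0; have mp := INR_gt0 m0; have np := INR_gt0 n0.
have h3 : INR (n %/ m) * r m <= INR n * (r m / INR m).
  have -> : INR (n %/ m) * r m = INR (n %/ m) * INR m * (r m / INR m) by field; lra.
  by apply: Rmult_le_compat_r => //; apply: Rle_mult_inv_pos.
apply: (Rmult_le_reg_l (INR n)) => //.
have -> : INR n * (r n / INR n) = r n by field; lra.
have -> : INR n * (r m / INR m + r m / INR n) = INR n * (r m / INR m) + r m by field; lra.
lra.
Qed.

Lemma INR_large (x eps : R) : 0 <= x -> 0 < eps ->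
  exists N, forall n, (N <= n)%N -> (0 < n)%N /\ x / INR n < eps.
Proof.
move=> x0 e0; have [N hN] := INR_unbounded (x / eps).
exists N.+1 => n hn; have n0 : (0 < n)%N by exact: leq_trans hn.
have np := INR_gt0 n0; split=> //.
have h : x / eps < INR n.
  by apply: Rlt_le_trans hN _; apply: le_INR; apply/leP; exact: ltnW.
apply: (Rmult_lt_reg_r (INR n)) => //.
have -> : x / INR n * INR n = x by field; lra.
have -> : x = x / eps * eps by field; lra.
by rewrite Rmult_comm; apply: Rmult_lt_compat_l.
Qed.

Definition efin (x : ereal) : R := if x is EFin a then a else 0.

(** One infinite term makes all later ones infinite, as u n >= u m + u (n - m). If all are finite,
    the limit is the supremum of the quotients, possibly infinite: [superadd_quot] lifts late
    quotients to within any error of an early one. *)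
Lemma fekete_super (u : nat -> ereal) : (forall n, ele (EFin 0) (u n)) ->
  (forall m n, ele (eadd (u m) (u n)) (u (m + n)%N)) ->
  exists l, econv (fun n => escale (/ INR n) (u n)) l /\
            forall n, (0 < n)%N -> ele (escale (/ INR n) (u n)) l.
Proof.
move=> u0 hu.
have ninv n : (0 < n)%N -> / INR n <> 0.
  by move=> /INR_gt0 h; apply: Rinv_neq_0_compat; lra.
have [[m um]|hfin] := excluded_middle_informative (exists m, u m = EInf).
  exists EInf; split=> [M|n _]; last by case: escale.
  exists m.+1 => n mn; have := hu m (n - m)%N; rewrite subnKC ?um; last exact: ltnW.
  have n0 : (0 < n)%N by exact: leq_trans mn.
  by case: (u n) => // _; rewrite escale_inf //; exact: ninv.
pose r n := efin (u n).
have ur n : u n = EFin (r n) by rewrite /r; case e : (u n) => //; case: hfin; exists n.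
have r0 n : 0 <= r n by have := u0 n; rewrite ur.
have hr m n : r m + r n <= r (m + n)%N by have := hu m n; rewrite !ur.
have key := superadd_quot r0 hr.
have vE n : escale (/ INR n) (u n) = EFin (r n / INR n) by rewrite ur /= Rmult_comm.
pose S x := exists n, (0 < n)%N /\ x = EFin (r n / INR n).
have hS : exists x, S x by exists (EFin (r 1%N / INR 1)), 1%N.
have [hub hlub] := esup_spec hS; exists (esup S); split; last first.
  by move=> n n0; rewrite vE; apply: hub; exists n.
have approx M : ~ ele (esup S) (EFin M) -> exists m, (0 < m)%N /\ M < r m / INR m.
  move=> h; apply: NNPP => hno; apply: h; apply: hlub => x [m [m0 ->]] /=.
  by apply: Rnot_lt_le => hlt; apply: hno; exists m.
case: (esup S) hub approx => [L|] hub approx.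
  move=> eps heps; have [|m [m0 hm]] := approx (L - eps / 2); first by move=> /=; lra.
  have [|N hN] := @INR_large (r m) (eps / 2) (r0 m); first lra.
  exists N => n /hN[n0 hn]; exists (r n / INR n); split; first exact: vE.
  have /= := hub (EFin (r n / INR n)) (ex_intro _ n (conj n0 erefl)).
  by have := key m n m0 n0 => ? ?; apply: Rabs_def1; lra.
move=> M; have [|m [m0 hm]] := approx (M + 1); first by [].
have [|N hN] := @INR_large (r m) 1 (r0 m); first lra.
exists N => n /hN[n0 hn]; rewrite vE /=.
by have := key m n m0 n0; lra.
Qed.

(** An infinite [u 1] spreads to all later terms by monotonicity. A finite one bounds [u 0] by
    monotonicity and every other term by subadditivity; the limit is then the infimum of the
    quotients, by [subadd_quot]. *)
Lemma fekete_sub (u : nat -> ereal) : (forall n, ele (EFin 0) (u n)) ->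
  (forall m n, ele (u m) (u (m + n)%N)) ->
  (forall m n, ele (u (m + n)%N) (eadd (u m) (u n))) ->
  exists l, econv (fun n => escale (/ INR n) (u n)) l /\
            forall n, (0 < n)%N -> ele l (escale (/ INR n) (u n)).
Proof.
move=> u0 hmon hu.
have ninv n : (0 < n)%N -> / INR n <> 0.
  by move=> /INR_gt0 h; apply: Rinv_neq_0_compat; lra.
case u1 : (u 1%N) => [a|]; last first.
  have hinf n : (0 < n)%N -> escale (/ INR n) (u n) = EInf.
    move=> n0; have := hmon 1%N n.-1; rewrite add1n prednK // u1.
    by case: (u n) => // _; rewrite escale_inf //; exact: ninv.
  exists EInf; split=> [M|n n0]; last by rewrite hinf.
  by exists 1%N => n n0; rewrite hinf.
have hfin n : exists b, u n = EFin b.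
  elim: n => [|n [b IH]].
    by have := hmon 0%N 1%N; rewrite add0n u1; case: (u 0%N) => // b _; exists b.
  by have := hu n 1%N; rewrite addn1 u1 IH /=; case: (u n.+1) => // c _; exists c.
pose r n := efin (u n).
have ur n : u n = EFin (r n) by rewrite /r; have [b ->] := hfin n.
have r0 n : 0 <= r n by have := u0 n; rewrite ur.
have hm m n : r m <= r (m + n)%N by have := hmon m n; rewrite !ur.
have hr m n : r (m + n)%N <= r m + r n by have := hu m n; rewrite !ur.
have key := subadd_quot r0 hm hr.
have vE n : escale (/ INR n) (u n) = EFin (r n / INR n) by rewrite ur /= Rmult_comm.
pose S x := exists n, (0 < n)%N /\ x = EFin (r n / INR n).
have hS x : S x -> ele (EFin 0) x.
  by move=> [n [n0 ->]] /=; apply: Rle_mult_inv_pos => //; exact: INR_gt0.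
have [hlb hglb] := einf_spec hS; exists (einf S); split; last first.
  by move=> n n0; rewrite vE; apply: hlb; exists n.
have hL := hlb (EFin (r 1%N / INR 1)) (ex_intro _ 1%N (conj isT erefl)).
have approx M : ~ ele (EFin M) (einf S) -> exists m, (0 < m)%N /\ r m / INR m < M.
  move=> h; apply: NNPP => hno; apply: h; apply: hglb => x [m [m0 ->]] /=.
  by apply: Rnot_lt_le => hlt; apply: hno; exists m.
case: (einf S) hlb approx hL => [L|] // hlb approx _.
move=> eps heps; have [|m [m0 hm']] := approx (L + eps / 2); first by move=> /=; lra.
have [|N hN] := @INR_large (r m) (eps / 2) (r0 m); first lra.
exists N => n /hN[n0 hn]; exists (r n / INR n); split; first exact: vE.
have /= := hlb (EFin (r n / INR n)) (ex_intro _ n (conj n0 erefl)).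
by have := key m n m0 n0 => ? ?; apply: Rabs_def1; lra.
Qed.

(** * Sums of suprema and of infima *)

Lemma esup_add S T U : (exists x, S x) -> (exists y, T y) ->
  (forall x y, S x -> T y -> ele (eadd x y) U) -> ele (eadd (esup S) (esup T)) U.
Proof.
move=> hS hT; case: U => [U|] h; last by case: eadd.
have [_ lS] := esup_spec hS; have [_ lT] := esup_spec hT.
(* The default value of [efin] at [EInf] is harmless: with [U] finite and [S] inhabited, [T] has no
   infinite element. *)
have h1 y : T y -> ele (esup S) (EFin (U - efin y)).
  by move=> Ty; apply: lS => x Sx; move: (h _ _ Sx Ty); case: x y {Sx Ty} => [x|] [y|] //=; lra.
case: (esup S) h1 => [a|] h1 /=; last by have [y /h1] := hT.
have /= : ele (esup T) (EFin (U - a)).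
  apply: lT => y Ty; have := h1 _ Ty; have [x Sx] := hS; have := h _ _ Sx Ty.
  by case: y {Ty} => [y|] /=; [lra | case: (x)].
by case: (esup T) => //= b; lra.
Qed.

Lemma einf_add S T U :
  (forall x, S x -> ele (EFin 0) x) -> (forall y, T y -> ele (EFin 0) y) ->
  (forall x y, S x -> T y -> ele U (eadd x y)) -> ele U (eadd (einf S) (einf T)).
Proof.
move=> hS hT h; have [_ lS] := einf_spec hS; have [_ lT] := einf_spec hT.
case eS : (einf S) => [a|]; last by case: (U).
case eT : (einf T) => [b|]; last by case: (U).
case: U h => [U|] h; last first.
  (* For infinite [U], a finite element of [S] forces every element of [T] to be infinite, against
     the finite infimum of [T]. *)
  have SN x : S (EFin x) -> False.
    move=> Sx; suff : ele EInf (einf T) by rewrite eT.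
    by apply: lT => -[y|] // /(h _ _ Sx).
  suff : ele EInf (einf S) by rewrite eS.
  by apply: lS => -[x|] // /SN.
have h1 y : T (EFin y) -> ele (EFin (U - y)) (einf S).
  by move=> Ty; apply: lS => -[x|] // Sx; have /= := h _ _ Sx Ty; lra.
have : ele (EFin (U - a)) (einf T).
  by apply: lT => -[y|] // /h1; rewrite eS /=; lra.
by rewrite eT /=; lra.
Qed.

End Ereal.

(** * Classical Fisher information *)

Lemma RplusA : associative Rplus. Proof. by move=> x y z; ring. Qed.
Lemma RplusC : commutative Rplus. Proof. by move=> x y; ring. Qed.
Lemma Rplus0 : left_id rzero Rplus. Proof. by move=> x; ring. Qed.
Lemma Rmult0l : left_zero rzero Rmult. Proof. by move=> x; ring. Qed.
Lemma Rmult0r : right_zero rzero Rmult. Proof. by move=> x; ring. Qed.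
Lemma RmultDl : left_distributive Rmult Rplus. Proof. by move=> x y z; ring. Qed.
Lemma RmultDr : right_distributive Rmult Rplus. Proof. by move=> x y z; ring. Qed.
HB.instance Definition _ := Monoid.isComLaw.Build R rzero Rplus RplusA RplusC Rplus0.
HB.instance Definition _ := Monoid.isMulLaw.Build R rzero Rmult Rmult0l Rmult0r.
HB.instance Definition _ := Monoid.isAddLaw.Build R Rmult Rplus RmultDl RmultDr.

Section Fisher.
Local Open Scope R_scope.

Lemma rsumM m n (v : 'I_m -> R) (w : 'I_n -> R) :
  rsum (fun k : 'I_(m * n) => v (idx k).1 * w (idx k).2) = rsum v * rsum w.
Proof.
rewrite /rsum big_mxvec big_distrlr /=.
by apply: eq_bigr => i _; apply: eq_bigr => j _; rewrite idx_mxvec.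
Qed.

Lemma rsumD m (v w : 'I_m -> R) : rsum (fun y => v y + w y) = rsum v + rsum w.
Proof. exact: big_split. Qed.

Lemma rsumZ m c (v : 'I_m -> R) : rsum (fun y => c * v y) = c * rsum v.
Proof. by rewrite /rsum big_distrr. Qed.

Lemma eq_rsum m (v w : 'I_m -> R) : v =1 w -> rsum v = rsum w.
Proof. by move=> e; apply: eq_bigr => y _. Qed.

Lemma rsum_neq0 m (v : 'I_m -> R) : rsum v <> 0 -> exists y, v y <> 0.
Proof.
move=> h; apply: NNPP => hno; apply: h; apply: big1 => y _.
by apply: NNPP => hy; apply: hno; exists y.
Qed.

Definition jterm m (p d : 'I_m -> R) y : R :=
  if Req_EM_T (p y) rzero then rzero else d y * d y / p y.

Lemma jterm0 m (p d : 'I_m -> R) y : p y = 0 -> jterm p d y = 0.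
Proof. by rewrite /jterm; case: Req_EM_T. Qed.

Lemma jtermN0 m (p d : 'I_m -> R) y : p y <> 0 -> jterm p d y = d y * d y / p y.
Proof. by rewrite /jterm; case: Req_EM_T. Qed.

Lemma Jfisher_inf m (p d : 'I_m -> R) y : p y = 0 -> d y <> 0 -> Jfisher p d = EInf.
Proof.
by rewrite /Jfisher; case: excluded_middle_informative => // h *; case: h; exists y.
Qed.

Lemma Jfisher_fin m (p d : 'I_m -> R) : (forall y, p y = 0 -> d y = 0) ->
  Jfisher p d = EFin (rsum (jterm p d)).
Proof.
by rewrite /Jfisher; case: excluded_middle_informative => // -[y [h1 h2]] /(_ y h1).
Qed.

Lemma Jfisher_case m (p d : 'I_m -> R) :
  (exists y, p y = 0 /\ d y <> 0) \/ (forall y, p y = 0 -> d y = 0).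
Proof.
have [h|h] := excluded_middle_informative (exists y, p y = 0 /\ d y <> 0); [by left|].
by right=> y hy; apply: NNPP => hd; apply: h; exists y.
Qed.

Lemma Jfisher_ge0 m (p d : 'I_m -> R) : (forall y, 0 <= p y) -> ele (EFin 0) (Jfisher p d).
Proof.
move=> p0; case: (Jfisher_case p d) => [[y [h1 h2]]|h]; first by rewrite (Jfisher_inf h1 h2).
rewrite Jfisher_fin //= /rsum; elim/big_rec: _ => [|y x _ hx]; first exact: Rle_refl.
apply: Rplus_le_le_0_compat => //; case: (Req_EM_T (p y) 0) => py.
  by rewrite jterm0 //; exact: Rle_refl.
rewrite jtermN0 //; apply: Rle_mult_inv_pos; first nra.
by have := p0 y; lra.
Qed.

Lemma Jfisher0 m (p : 'I_m -> R) : Jfisher p (fun _ => 0) = EFin 0.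
Proof.
rewrite Jfisher_fin //; congr EFin; apply: big1 => y _.
case: (Req_EM_T (p y) 0) => py; first by rewrite jterm0.
by rewrite jtermN0 //; field.
Qed.

Lemma Jfisher_scale m (p d : 'I_m -> R) t :
  Jfisher p (fun y => t * d y) = escale (t * t) (Jfisher p d).
Proof.
case: (Req_EM_T t 0) => [->|t0].
  rewrite Rmult_0_l escale0 -(Jfisher0 p); congr Jfisher.
  by apply: functional_extensionality => y; rewrite Rmult_0_l.
case: (Jfisher_case p d) => [[y [h1 h2]]|h].
  rewrite (Jfisher_inf h1 h2) escale_inf; last by nra.
  by apply: (Jfisher_inf h1); nra.
rewrite !Jfisher_fin /=; [|by []|by move=> y /h ->; rewrite Rmult_0_r].
congr EFin; rewrite -rsumZ; apply: eq_rsum => y.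
case: (Req_EM_T (p y) 0) => py; first by rewrite !jterm0 // Rmult_0_r.
by rewrite !jtermN0 //; field.
Qed.

(** On the support, (d q + p e)^2 / (p q) = (d^2 / p) q + 2 d e + p (e^2 / q). The cross term sums
    to zero because both tangents do. *)
Lemma Jfisher_prod m n (p d : 'I_m -> R) (q e : 'I_n -> R) :
  rsum p = 1 -> rsum d = 0 -> rsum q = 1 -> rsum e = 0 ->
  Jfisher (fun k : 'I_(m * n) => p (idx k).1 * q (idx k).2)
          (fun k => d (idx k).1 * q (idx k).2 + p (idx k).1 * e (idx k).2)
  = eadd (Jfisher p d) (Jfisher q e).
Proof.
move=> sp sd sq se.
case: (Jfisher_case p d) => [[y [h1 h2]]|hp].
  (* The infinite term at [y] survives in the product only beside a point with [q z] nonzero; total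
     mass 1 provides such a point. *)
  have [|z hz] := @rsum_neq0 _ q; first by rewrite sq; lra.
  rewrite (Jfisher_inf h1 h2); apply: (@Jfisher_inf _ _ _ (mxvec_index y z));
    rewrite !idx_mxvec /= h1; first by ring.
  by rewrite Rmult_0_l Rplus_0_r; nra.
case: (Jfisher_case q e) => [[z [h1 h2]]|hq].
  have [|y hy] := @rsum_neq0 _ p; first by rewrite sp; lra.
  rewrite (Jfisher_inf h1 h2) [eadd _ _](_ : _ = EInf); last by case: Jfisher.
  apply: (@Jfisher_inf _ _ _ (mxvec_index y z)); rewrite !idx_mxvec /= h1; first by ring.
  by rewrite Rmult_0_r Rplus_0_l; nra.
rewrite !Jfisher_fin //=; last first.
  by move=> k /Rmult_integral[] h; [rewrite (hp _ h) | rewrite (hq _ h)]; rewrite h; ring.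
congr EFin.
transitivity (rsum (fun k : 'I_(m * n) =>
    jterm p d (idx k).1 * q (idx k).2 +
    (2 * (d (idx k).1 * e (idx k).2) + p (idx k).1 * jterm q e (idx k).2))).
  apply: eq_rsum => k.
  case: (Req_EM_T (p (idx k).1) 0) => hy.
    by rewrite jterm0 ?hy ?(hp _ hy) ?[jterm p d _]jterm0 //; ring.
  case: (Req_EM_T (q (idx k).2) 0) => hz.
    by rewrite jterm0 ?hz ?(hq _ hz) ?[jterm q e _]jterm0 //; ring.
  rewrite jtermN0 ?[jterm p d _]jtermN0 ?[jterm q e _]jtermN0 //; last by nra.
  by field.
by rewrite !rsumD rsumZ !rsumM sp sd sq se; ring.
Qed.
End Fisher.

(** * Classical pairs *)

Record cdist := CDist {
  csize : nat;
  cprob : 'I_csize -> R;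
  ctang : 'I_csize -> R;
  cprobP : is_dist cprob;
  ctangP : is_cl_tangent ctang
}.
Arguments cprob : clear implicits.
Arguments ctang : clear implicits.

Definition cfisher c : ereal := Jfisher (cprob c) (ctang c).

Lemma cfisher_ge0 c : ele (EFin rzero) (cfisher c).
Proof. by apply: Jfisher_ge0; case: (cprobP c). Qed.

Lemma csize_gt0 c : (0 < csize c)%N.
Proof.
case: c => -[|m] //= p d [_ hp] _; exfalso; move: hp.
by rewrite /rsum big_ord0; lra.
Qed.

Lemma tr_dmx m (v : 'I_m -> R) : \tr (dmx v) = rC (rsum v).
Proof. by rewrite mxtrace_diag rC_sum; apply: eq_bigr => i _; rewrite mxE. Qed.

Lemma herm_dmx m (v : 'I_m -> R) : hermitian (dmx v).
Proof.
apply/matrixP=> i j; rewrite !mxE [j == i]eq_sym; case: eqP => [->|_]; last by rewrite rmorph0.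
by rewrite !mulr1n; cpx_ring.
Qed.

Lemma psd_dmx m (v : 'I_m -> R) : (forall y, Rle rzero (v y)) -> psd (dmx v).
Proof.
move=> v0; pose w y := sqrt (v y).
suff -> : dmx v = dmx w *m 1%:M *m adj (dmx w) by apply: psd_conj; exact: psd_scalar1.
rewrite herm_dmx mulmx1 mulmx_diag; congr diag_mx; apply/matrixP=> i j; rewrite !mxE -rCM.
by rewrite sqrt_sqrt.
Qed.

Lemma ch_cl_map c : is_channel (cl_map (cprob c)).
Proof.
apply: ch_state; case: (cprobP c) => p0 p1; split; first exact: psd_dmx.
by rewrite tr_dmx p1.
Qed.

Lemma tan_cl_map c : is_tangent (cl_map (ctang c)).
Proof.
split=> [|X hX|X]; first by apply: lin_scaled => a X Y; rewrite !mxE.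
  by rewrite /hermitian adjZ herm_dmx; move/matrixP/(_ ord0 ord0): hX; rewrite mxE => ->.
by rewrite mxtraceZ tr_dmx ctangP mulr0.
Qed.

Definition cpair_of c : cpair := CPair (ltn0Sn 0) (csize_gt0 c) (ch_cl_map c) (tan_cl_map c).

Lemma cprod_dist c e :
  is_dist (fun k : 'I_(csize c * csize e) => cprob c (idx k).1 * cprob e (idx k).2)%coqR.
Proof.
case: (cprobP c) (cprobP e) => p0 p1 [q0 q1]; split; last by rewrite rsumM p1 q1; ring.
by move=> y; apply: Rmult_le_pos.
Qed.

Lemma cprod_tang c e :
  is_cl_tangent (fun k : 'I_(csize c * csize e) =>
     ctang c (idx k).1 * cprob e (idx k).2 + cprob c (idx k).1 * ctang e (idx k).2)%coqR.
Proof. by rewrite /is_cl_tangent rsumD !rsumM !ctangP; ring. Qed.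

Definition cprod c e : cdist := CDist (cprod_dist c e) (cprod_tang c e).

Lemma cfisher_prod c e : cfisher (cprod c e) = eadd (cfisher c) (cfisher e).
Proof.
by apply: Jfisher_prod; try exact: ctangP; [case: (cprobP c) | case: (cprobP e)].
Qed.

Lemma kron_dmx m n (v : 'I_m -> R) (w : 'I_n -> R) :
  kron (dmx v) (dmx w) = dmx (fun k => v (idx k).1 * w (idx k).2)%coqR.
Proof.
apply: mxvec_matrixP => i j k l; rewrite kronE !mxE mxvec_index_eq idx_mxvec /= rCM.
by case: eqP => _; case: eqP => _; rewrite /= ?mulr1n ?mulr0n ?mul0r ?mulr0.
Qed.

Lemma dmxD m (v w : 'I_m -> R) : dmx (fun y => v y + w y)%coqR = dmx v + dmx w.
Proof. by apply/matrixP=> i j; rewrite !mxE -mulrnDl rCD. Qed.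

Lemma dmxZ m t (v : 'I_m -> R) : dmx (fun y => t * v y)%coqR = rC t *: dmx v.
Proof. by apply/matrixP=> i j; rewrite !mxE rCM mulrnAr. Qed.

Lemma lin_cl_map m (v : 'I_m -> R) : is_linmap (cl_map v).
Proof. by apply: lin_scaled => c X Y; rewrite !mxE. Qed.

Lemma tens_cl_map m n (v : 'I_m -> R) (w : 'I_n -> R) X :
  tensmap (cl_map v) (cl_map w) X =
  runit X ord0 ord0 *: dmx (fun k => v (idx k).1 * w (idx k).2)%coqR.
Proof.
move: X; apply: tens_ext; first exact: lin_tens.
  by apply: lin_scaled => c X Y; rewrite (ch_lin (@ch_runit _)) !mxE.
move=> A B; rewrite tens_kron; try exact: lin_cl_map.
rewrite runit_kron mxE /cl_map (linZ (@kron_linl _ _ _)) (linZ (@kron_linr _ _ _)).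
by rewrite kron_dmx scalerA mulrC.
Qed.

Lemma ple_cprod c e : cpair_of c \ox cpair_of e <~ cpair_of (cprod c e).
Proof.
exists (@runit 1), id; split=> [||X|X] /=; [exact: ch_runit | exact: ch_id | |].
  by rewrite tens_cl_map.
by rewrite !tens_cl_map -scalerDr -dmxD.
Qed.

Lemma ple_cprodV c e : cpair_of (cprod c e) <~ cpair_of c \ox cpair_of e.
Proof.
exists (@runitV 1), id; split=> [||X|X] /=; [exact: ch_runitV | exact: ch_id | |];
  rewrite !tens_cl_map runitK //.
by rewrite -scalerDr -dmxD.
Qed.

Lemma cscale_tang t c : is_cl_tangent (fun y => t * ctang c y)%coqR.
Proof. by rewrite /is_cl_tangent rsumZ ctangP; ring. Qed.

Definition cscale t c : cdist := CDist (cprobP c) (cscale_tang t c).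

Lemma cfisher_scale t c : cfisher (cscale t c) = escale (t * t)%coqR (cfisher c).
Proof. exact: Jfisher_scale. Qed.

Lemma ple_cscale t c : cpair_of (cscale t c) <~ smul t (cpair_of c).
Proof. by apply: ple_eq => // X; rewrite /cl_map /rscale dmxZ !scalerA mulrC. Qed.

Lemma ple_smul_cpair t c : smul t (cpair_of c) <~ cpair_of (cscale t c).
Proof. by apply: ple_eq => // X; rewrite /cl_map /rscale dmxZ !scalerA mulrC. Qed.

Lemma cone_dist : is_dist (fun _ : 'I_1 => rone).
Proof. by split=> [_|]; [lra | rewrite /rsum big_ord1]. Qed.

Lemma cone_tang : is_cl_tangent (fun _ : 'I_1 => rzero).
Proof. by rewrite /is_cl_tangent /rsum big_ord1. Qed.

(** The one-point distribution, a classical form of the tensor unit; it makes [inner] inhabited and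
    stands for zero cost in [outer]. *)
Definition cone : cdist := CDist cone_dist cone_tang.

Lemma cfisher_cone : cfisher cone = EFin rzero.
Proof. exact: Jfisher0. Qed.

Lemma ple_cone P : cpair_of cone <~ P.
Proof.
apply: ple_trans (ple_one P); apply: ple_eq => X; rewrite /cl_map.
  rewrite [RHS]mx11E; congr (_ *: _).
  by apply/matrixP=> i j; rewrite !mxE.
rewrite [dmx _](_ : _ = 0) ?scaler0 //.
by apply/matrixP=> i j; rewrite !mxE mul0rn.
Qed.

(** * The minimal and maximal metrics as extrema over classical pairs *)

Definition gval (G : cmetric) (P : cpair) : ereal := G _ _ (chan P) (tang P).

Lemma tang_tens_id P k (k0 : (0 < k)%N) X :
  tang (P \ox idpair k0) X = tensI (tang P) k X.
Proof. by rewrite /= tens_zeror addr0. Qed.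

Definition inner P (v : ereal) : Prop :=
  exists c k (k0 : (0 < k)%N), cpair_of c <~ P \ox idpair k0 /\ v = cfisher c.

Definition outer P (v : ereal) : Prop :=
  exists c k (k0 : (0 < k)%N), P <~ cpair_of c \ox idpair k0 /\ v = cfisher c.

(** The state is a preprocessing from C, the measurement a postprocessing. [povm_out] keeps real
    parts only, so the diagonals must be shown real: by positivity for [p], by Hermiticity for
    [d]. *)
Lemma measured_inner P k (rho : Mx (din P * k)) m (M : 'I_m -> Mx (dout P * k)) :
  (0 < k)%N -> is_state rho -> is_povm M ->
  inner P (Jfisher (povm_out M (tensI (chan P) k rho)) (povm_out M (tensI (tang P) k rho))).
Proof.
move=> k0 hrho hM; pose Q := P \ox idpair k0.
have cpost := ch_povm hM; set post := (fun X => _) in cpost.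
have postE X y : post X y y = \tr (X *m M y) by rewrite !mxE eqxx mulr1n.
set p := povm_out _ _; set d := povm_out _ _.
have cQ : psd (post (tensI (chan P) k rho)).
  by apply: ch_psd => //; apply: (ch_psd (chanP Q)); case: hrho.
have hQ : hermitian (post (tensI (tang P) k rho)).
  apply: ch_herm => //; rewrite -(@tang_tens_id P k k0).
  by have [_ h _] := tangP Q; apply: h; apply: psd_herm; case: hrho.
have ep : dmx p = post (tensI (chan P) k rho).
  congr diag_mx; apply/matrixP=> i j; rewrite !mxE; apply: cpx_ext => //=.
  by have [h _] := psd_diag j cQ; rewrite -h postE.
have ed : dmx d = post (tensI (tang P) k rho).
  congr diag_mx; apply/matrixP=> i j; rewrite !mxE; apply: cpx_ext => //=.
  have := congr1 Im (postE (tensI (tang P) k rho) j).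
  by rewrite -{1}hQ mxE cpxE postE; lra.
have pP : is_dist p.
  split=> [y|]; first by have [_] := psd_diag y cQ; rewrite postE.
  have : rC (rsum p) = 1.
    rewrite -tr_dmx ep; have [_ _ ->] := cpost.
    by have [_ _ ->] := chanP Q; case: hrho.
  by move/(congr1 Re).
have dP : is_cl_tangent d.
  have : rC (rsum d) = 0.
    rewrite -tr_dmx ed; have [_ _ ->] := cpost; rewrite -(@tang_tens_id P k k0).
    by have [_ _ ->] := tangP Q.
  by move/(congr1 Re).
exists (CDist pP dP), k, k0; split=> //.
exists (fun X : Mx 1 => X ord0 ord0 *: rho), post; split=> // [|X|X].
- exact: ch_state.
- by rewrite (linZ (@chan_lin _)) (linZ (ch_lin cpost)) /= /cl_map ep.
- by rewrite (linZ (@tang_lin _)) (linZ (ch_lin cpost)) tang_tens_id /= /cl_map ed.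
Qed.

(* The effects of the measurement are the duals of the diagonal matrix units. *)
Lemma inner_measured P v : inner P v ->
  exists k (rho : Mx (din P * k)) m (M : 'I_m -> Mx (dout P * k)),
    [/\ (0 < k)%N, is_state rho, is_povm M &
     v = Jfisher (povm_out M (tensI (chan P) k rho)) (povm_out M (tensI (tang P) k rho))].
Proof.
move=> [c [k [k0 [[pre [post [hpre hpost e1 e2]]] ->]]]].
have lpost := ch_lin hpost.
pose M y : Mx (dout P * k) := \matrix_(j, i) post (delta_mx i j) y y.
have trM X y : \tr (X *m M y) = post X y y.
  rewrite (lin_delta lpost X) /mxtrace summxE; apply: eq_bigr => i _.
  rewrite mxE summxE; apply: eq_bigr => j _.
  by rewrite [M y j i]mxE mxZE.
exists k, (pre 1%:M), (csize c), M; split=> //.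
- split; first by apply: ch_psd => //; exact: psd_scalar1.
  by have [_ _ ->] := hpre; rewrite mxtrace1.
- split=> [y w|].
    have [h1 h2] := psd_diag y (ch_psd hpost (psd_outer w)).
    suff -> : (adj w *m M y *m w) ord0 ord0 = post (w *m adj w) y y by [].
    by rewrite -trM -[in RHS]mulmxA [RHS]mxtrace_mulC tr1.
  apply/matrixP=> j i; rewrite summxE !mxE.
  transitivity (\tr (post (delta_mx i j))); first by apply: eq_bigr => y _; rewrite mxE.
  have [_ _ ->] := hpost; rewrite /mxtrace (bigD1 i) //= big1 => [|l li].
    by rewrite mxE eqxx addr0 eq_sym.
  by rewrite mxE (negPf li).
- rewrite /cfisher; congr Jfisher; apply: functional_extensionality => y.
    rewrite /povm_out trM -[tensI _ _ _]/(chan (P \ox idpair k0) (pre 1%:M)) -e1 /=.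
    by rewrite /cl_map !mxE !eqxx mulr1n mul1r.
  rewrite /povm_out trM -(@tang_tens_id P k k0) -e2 /=.
  by rewrite /cl_map !mxE !eqxx mulr1n mul1r.
Qed.

Lemma gminE P : gval Gmin P = esup (inner P).
Proof.
congr esup; apply: functional_extensionality => v; apply: propositional_extensionality.
split=> [[k [rho [m [M [k0 hrho hM ->]]]]]|]; first exact: measured_inner.
exact: inner_measured.
Qed.

(** Swap followed by the right unit identifies C tensor K with K; a classical pair beside an ancilla
    just attaches its vector. *)
Lemma cl_tens_id m k (v : 'I_m -> R) (Y : Mx (1 * k)) :
  tensmap (cl_map v) id Y = kron (dmx v) (runit (swapmx Y)).
Proof.
move: Y; apply: tens_ext; first exact: lin_tens.
  apply: lin_comp; first exact: kron_linr.
  by apply: lin_comp; exact: lin_mxsub.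
move=> A B; rewrite tens_kron //; last exact: lin_cl_map.
by rewrite swap_kron runit_kron /cl_map (linZ (@kron_linl _ _ _)) (linZ (@kron_linr _ _ _)).
Qed.

(** A simulation [Lam] is a postprocessing whose ancilla is the input space itself. Conversely a
    preprocessing acts on the input alone, since the classical pair has input C, and is absorbed:
    [Lam] sends X tensor Y to [post] of Y tensor [pre' X]. *)
Lemma gmaxE P : gval Gmax P = einf (outer P).
Proof.
congr einf; apply: functional_extensionality => v; apply: propositional_extensionality.
split=> [[m [q [d [Lam [hq hd hL [e1 e2] ->]]]]]|[c [k [k0 [[pre [post [hpre hpost e1 e2]]] ->]]]]].
  exists (CDist hq hd), (din P), (din_gt0 P); split=> //.
  exists (fun X => swapmx (runitV X)), (fun X => Lam (swapmx X)); split.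
  - by apply: ch_comp; [exact: ch_swap | exact: ch_runitV].
  - by apply: ch_comp => //; exact: ch_swap.
  - move=> X; rewrite e1 /= cl_tens_id swap_kron runitVE !swap_kron runit_kron.
    by rewrite mxE eqxx scale1r.
  - move=> X; rewrite e2 tang_tens_id /tensI cl_tens_id swap_kron runitVE !swap_kron runit_kron.
    by rewrite mxE eqxx scale1r.
pose pre' X := runit (swapmx (pre X)).
have hpre' : is_channel pre'.
  by apply: ch_comp (@ch_runit _) _; apply: ch_comp (@ch_swap _ _) _.
exists (csize c), (cprob c), (ctang c), (fun X => post (swapmx (tensmap pre' id X))).
split; [exact: cprobP | exact: ctangP | | | by []].
  apply: ch_comp => //; apply: ch_comp (@ch_swap _ _) _.
  by apply: ch_tens; [exact: din_gt0 | exact: csize_gt0 | | exact: ch_id].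
by split=> X; rewrite tens_kron //; try exact: ch_lin; rewrite swap_kron ?e1 ?e2 ?tang_tens_id
  /= /tensI cl_tens_id.
Qed.

Lemma inner_nonempty P : exists v, inner P v.
Proof. by exists (cfisher cone), cone, 1%N, isT; split=> //; exact: ple_cone. Qed.

Lemma outer_ge0 P v : outer P v -> ele (EFin rzero) v.
Proof. by move=> [c [k [k0 [_ ->]]]]; exact: cfisher_ge0. Qed.

Lemma gmin_ub P v : inner P v -> ele v (gval Gmin P).
Proof. by rewrite gminE; have [h _] := esup_spec (inner_nonempty P); apply: h. Qed.

Lemma gmin_lub P u : (forall v, inner P v -> ele v u) -> ele (gval Gmin P) u.
Proof. by rewrite gminE; have [_ h] := esup_spec (inner_nonempty P); apply: h. Qed.

Lemma gmax_lb P v : outer P v -> ele (gval Gmax P) v.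
Proof. by rewrite gmaxE; have [h _] := einf_spec (@outer_ge0 P); apply: h. Qed.

Lemma gmax_glb P u : (forall v, outer P v -> ele u v) -> ele u (gval Gmax P).
Proof. by rewrite gmaxE; have [_ h] := einf_spec (@outer_ge0 P); apply: h. Qed.

Lemma gmin_ge0 P : ele (EFin rzero) (gval Gmin P).
Proof.
rewrite -cfisher_cone; apply: gmin_ub.
by exists cone, 1%N, isT; split=> //; exact: ple_cone.
Qed.

Lemma gmax_ge0 P : ele (EFin rzero) (gval Gmax P).
Proof. by apply: gmax_glb => v; exact: outer_ge0. Qed.

Lemma gmin_mono P Q : P <~ Q -> ele (gval Gmin P) (gval Gmin Q).
Proof.
move=> h; apply: gmin_lub => v [c [k [k0 [hc ->]]]]; apply: gmin_ub.
exists c, k, k0; split=> //; apply: ple_trans hc _.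
by apply: ple_tens => //; exact: ple_refl.
Qed.

Lemma gmax_mono P Q : P <~ Q -> ele (gval Gmax P) (gval Gmax Q).
Proof.
move=> h; apply: gmax_glb => v [c [k [k0 [hc ->]]]]; apply: gmax_lb.
by exists c, k, k0; split=> //; apply: ple_trans h hc.
Qed.

Lemma gmin_super P Q : ele (eadd (gval Gmin P) (gval Gmin Q)) (gval Gmin (P \ox Q)).
Proof.
rewrite (gminE P) (gminE Q); apply: esup_add; try exact: inner_nonempty.
move=> x y [c [k [k0 [hc ->]]]] [e [l [l0 [he ->]]]]; rewrite -cfisher_prod.
apply: gmin_ub; exists (cprod c e), (k * l)%N, (muln_pos k0 l0); split=> //.
apply: ple_trans (ple_cprodV _ _) _; apply: ple_trans (ple_tens hc he) _.
apply: ple_trans (ple_tensACA _ _ _ _) _.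
by apply: ple_tens; [exact: ple_refl | exact: ple_idpair_tens].
Qed.

Lemma gmax_sub P Q : ele (gval Gmax (P \ox Q)) (eadd (gval Gmax P) (gval Gmax Q)).
Proof.
rewrite (gmaxE P) (gmaxE Q); apply: einf_add; try exact: outer_ge0.
move=> x y [c [k [k0 [hc ->]]]] [e [l [l0 [he ->]]]]; rewrite -cfisher_prod.
apply: gmax_lb; exists (cprod c e), (k * l)%N, (muln_pos k0 l0); split=> //.
apply: ple_trans (ple_tens hc he) _; apply: ple_trans (ple_tensACA _ _ _ _) _.
by apply: ple_tens; [exact: ple_cprod | exact: ple_idpair_tens].
Qed.

Lemma gmin_tens_id P k (k0 : (0 < k)%N) : ele (gval Gmin (P \ox idpair k0)) (gval Gmin P).
Proof.
apply: gmin_lub => v [c [l [l0 [hc ->]]]]; apply: gmin_ub.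
exists c, (k * l)%N, (muln_pos k0 l0); split=> //; apply: ple_trans hc _.
apply: ple_trans (ple_assoc _ _ _) _.
by apply: ple_tens; [exact: ple_refl | exact: ple_idpair_tens].
Qed.

Lemma gmax_tens_id P k (k0 : (0 < k)%N) : ele (gval Gmax (P \ox idpair k0)) (gval Gmax P).
Proof.
apply: gmax_glb => v [c [l [l0 [hc ->]]]]; apply: gmax_lb.
exists c, (l * k)%N, (muln_pos l0 k0); split=> //.
apply: (@ple_trans (cpair_of c \ox idpair l0 \ox idpair k0)).
  by apply: ple_tens => //; exact: ple_refl.
apply: ple_trans (ple_assoc _ _ _) _.
by apply: ple_tens; [exact: ple_refl | exact: ple_idpair_tens].
Qed.

(** * Quadratic homogeneity *)

Lemma sqr_pos (t : R) : t <> rzero -> (rzero < t * t)%coqR.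
Proof. by move=> t0; nra. Qed.

Lemma escale_le_inv (c : R) x y : (rzero < c)%coqR ->
  ele (escale (/ c)%coqR x) y -> ele x (escale c y).
Proof.
move=> c0 /(escale_le (Rlt_le _ _ c0)).
by rewrite escale_comp Rinv_r ?escale1 //; lra.
Qed.

(* Rescaling by [1 / t] turns one inequality into the other. *)
Lemma homogeneous_of_le (f : cpair -> ereal) :
  (forall P Q, P <~ Q -> ele (f P) (f Q)) ->
  (forall t P, t <> rzero -> ele (f (smul t P)) (escale (t * t)%coqR (f P))) ->
  (forall P, f (smul rzero P) = EFin rzero) ->
  forall t P, f (smul t P) = escale (t * t)%coqR (f P).
Proof.
move=> fmono fle f0 t P; case: (Req_EM_T t rzero) => [->|t0].
  by rewrite f0 Rmult_0_l escale0.
apply: ele_antisym; first exact: fle.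
have ti : (/ t)%coqR <> rzero by exact: Rinv_neq_0_compat.
have h := ele_trans (fmono _ _ (ple_smulKV P t0)) (fle _ (smul t P) ti).
have := escale_le (Rlt_le _ _ (sqr_pos t0)) h; rewrite escale_comp.
have -> : (t * t * (/ t * / t) = 1)%coqR by field.
by rewrite escale1.
Qed.

Lemma gmin_smul t P : gval Gmin (smul t P) = escale (t * t)%coqR (gval Gmin P).
Proof.
move: t P; apply: homogeneous_of_le => [P Q|t P t0|P]; first exact: gmin_mono.
  apply: gmin_lub => v [c [k [k0 [hc ->]]]].
  apply: escale_le_inv; first exact: sqr_pos.
  rewrite Rinv_mult -cfisher_scale; apply: gmin_ub.
  (* Rescaling the relation for [c] by 1 / t undoes the factor [t] on [P] and leaves the ancilla
     unchanged. *)
  exists (cscale (/ t)%coqR c), k, k0; split=> //.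
  apply: ple_trans (ple_cscale _ _) _; apply: ple_trans (ple_smul _ hc) _.
  apply: ple_trans (ple_smul_tens _ _ _) _.
  by apply: ple_tens; [exact: ple_smulK | exact: ple_smul_idpair].
apply: ele_antisym; last exact: gmin_ge0.
apply: gmin_lub => v [c [k [k0 [[pre [post [_ hpost _ e2]]] ->]]]].
(* The tangent of [smul rzero P] vanishes, and linear postprocessing keeps it zero. *)
suff d0 : ctang c = (fun _ => rzero) by rewrite /cfisher d0 Jfisher0; exact: ele_refl.
apply: functional_extensionality => y.
have := e2 1%:M; rewrite tang_tens_id /tensI /= tens_rscale_l.
rewrite (linZ (ch_lin hpost)) => /matrixP/(_ y y).
rewrite /cl_map !mxE !eqxx mulr1n mul1r => /(congr1 Re).
by rewrite !cpxE => ->; ring.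
Qed.

Lemma gmax_smul t P : gval Gmax (smul t P) = escale (t * t)%coqR (gval Gmax P).
Proof.
move: t P; apply: homogeneous_of_le => [P Q|t P t0|P]; first exact: gmax_mono.
  apply: escale_le_inv; first exact: sqr_pos.
  apply: gmax_glb => v [c [k [k0 [hc ->]]]].
  have tt := sqr_pos t0.
  have h : ele (gval Gmax (smul t P)) (escale (t * t)%coqR (cfisher c)).
    rewrite -cfisher_scale; apply: gmax_lb; exists (cscale t c), k, k0; split=> //.
    apply: ple_trans (ple_smul t hc) _; apply: ple_trans (ple_smul_tens _ _ _) _.
    by apply: ple_tens; [exact: ple_smul_cpair | exact: ple_smul_idpair].
  have := escale_le (Rlt_le _ _ (Rinv_0_lt_compat _ tt)) h.
  by rewrite escale_comp Rinv_l ?escale1 //; lra.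
apply: ele_antisym; last exact: gmax_ge0.
(* With zero tangent the channel simulates itself: the ancilla carries the input, [chan P] is the
   postprocessing, and the classical part is trivial. The value is 0 even if [gval Gmax P] is
   infinite. *)
rewrite -cfisher_cone; apply: gmax_lb; exists cone, (din P), (din_gt0 P); split=> //.
apply: (@ple_trans (one_pair \ox idpair (din_gt0 P))); last first.
  by apply: ple_tens; [exact: ple_one | exact: ple_refl].
apply: (@ple_trans (idpair (din_gt0 P) \ox one_pair)); last exact: ple_swap.
apply: (ple_trans _ (ple_unitV _)).
exists id, (chan P); split=> //= [||X]; [exact: ch_id | exact: chanP |].
rewrite (lin0 (@chan_lin P)) /rscale.
by rewrite [rC rzero](_ : _ = 0) ?scale0r.
Qed.

(** * Regularization *)

(** [reg Gmin] and [reg Gmax] unfold to [Gminp] and [Gmaxp], so the axioms other than (N) are proved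
    once for both. *)
Definition reg (G : cmetric) : cmetric := fun a1 a2 Phi D => elim (regseq G Phi D).

Section Regularization.
Variable F : cmetric.
Arguments F : clear implicits.
Let f := gval F.
Hypothesis f_ge0 : forall P, ele (EFin rzero) (f P).
Hypothesis f_mono : forall P Q, P <~ Q -> ele (f P) (f Q).
Hypothesis f_tens_id : forall P k (k0 : (0 < k)%N), ele (f (P \ox idpair k0)) (f P).
Hypothesis f_smul : forall t P, f (smul t P) = escale (t * t)%coqR (f P).
Hypothesis f_lim : forall P, exists l, econv (regseq F (chan P) (tang P)) l.

Lemma inv_INR_ge0 n : (rzero <= / INR n)%coqR.
Proof.
(* [/ INR 0] is 0 by convention, which lets sequences be compared from index 0 on. *)
case: n => [|n]; first by rewrite Rinv_0; exact: Rle_refl.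
by apply: Rlt_le; apply: Rinv_0_lt_compat; apply: INR_gt0.
Qed.

Lemma reg_conv P : econv (regseq F (chan P) (tang P)) (gval (reg F) P).
Proof. by have [l h] := f_lim P; rewrite /gval /reg (elim_eq h). Qed.

Lemma reg_ge0 P : ele (EFin rzero) (gval (reg F) P).
Proof.
apply: (econv_le (N := 0) (econv_const _) (reg_conv P)) => n _.
by apply: escale_ge0 (inv_INR_ge0 n) _; exact: (f_ge0 (ppow P n)).
Qed.

Lemma reg_mono P Q : P <~ Q -> ele (gval (reg F) P) (gval (reg F) Q).
Proof.
move=> h; apply: (econv_le (N := 0) (reg_conv P) (reg_conv Q)) => n _.
by apply: escale_le (inv_INR_ge0 n) _; apply: (f_mono (ple_pow n h)).
Qed.

Lemma reg_tens_id P k (k0 : (0 < k)%N) : gval (reg F) (P \ox idpair k0) = gval (reg F) P.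
Proof.
apply: ele_antisym; last by apply: reg_mono; exact: ple_tensr.
apply: (econv_le (N := 0) (reg_conv _) (reg_conv _)) => n _.
apply: escale_le (inv_INR_ge0 n) _.
apply: (ele_trans _ (f_tens_id (ppow P n) (tpow_gt0 n k0))).
apply: (f_mono (P := ppow _ n)); apply: ple_trans (ple_pow_tens _ _ _) _.
by apply: ple_tens; [exact: ple_refl | exact: ple_pow_id].
Qed.

Lemma reg_smul t P : gval (reg F) (smul t P) = escale (t * t)%coqR (gval (reg F) P).
Proof.
apply: elim_eq; have tt : (rzero <= t * t)%coqR by nra.
apply: (econv_ext (N := 0) (econv_scale tt (reg_conv P))) => n _.
rewrite /regseq escale_comp Rmult_comm -escale_comp -[F _ _ _ _]/(f (ppow P n)).
rewrite -f_smul; congr escale; rewrite -[RHS]/(f (ppow (smul t P) n)).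
by apply: ele_antisym; apply: f_mono; [exact: ple_smul_pow | exact: ple_pow_smul].
Qed.

(** The m-th term for [ppow P n] is [n] times the term of index m n for [P], so the limit is that of
    a rescaled subsequence. (Ap) follows, its sequence being constant from index 1 on. *)
Lemma reg_pow P n : (0 < n)%N -> gval (reg F) (ppow P n) = escale (INR n) (gval (reg F) P).
Proof.
move=> n0; apply: elim_eq; have np := INR_gt0 n0.
apply: (econv_ext (N := 1) (econv_scale (Rlt_le _ _ np) (econv_sub n0 (reg_conv P)))) => m m0.
have mp := INR_gt0 m0.
rewrite /regseq escale_comp mult_INR.
have -> : (INR n * / (INR m * INR n) = / INR m)%coqR by field; lra.
congr escale; rewrite -[LHS]/(f (ppow P (m * n))) -[RHS]/(f (ppow (ppow P n) m)).
by apply: ele_antisym; apply: f_mono; [exact: ple_powMV | exact: ple_powM].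
Qed.

Lemma reg_channel_metric : is_channel_metric (reg F).
Proof.
move=> a1 a2 Phi D h1 h2 hP hD; pose P := CPair h1 h2 hP hD.
by split=> [|t]; [exact: (reg_ge0 P) | exact: (reg_smul t P)].
Qed.

Lemma reg_M : axiom_M (reg F).
Proof.
split=> [a0 a1 a2 Phi D Psi h0 h1 h2 hP hD hPsi|a1 a2 a3 Phi D Psi h1 h2 h3 hP hD hPsi].
  pose P := CPair h1 h2 hP hD.
  pose Q := CPair h0 h2 (ch_comp hP hPsi) (tan_pre hD hPsi).
  by apply: (@reg_mono Q P); exists Psi, id; split=> //; exact: ch_id.
pose P := CPair h1 h2 hP hD.
pose Q := CPair h1 h3 (ch_comp hPsi hP) (tan_post hD hPsi).
by apply: (@reg_mono Q P); exists id, Psi; split=> //; exact: ch_id.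
Qed.

Lemma reg_E : axiom_E (reg F).
Proof.
move=> a1 a2 Phi D k h1 h2 k0 hP hD; pose P := CPair h1 h2 hP hD.
rewrite -[RHS]/(gval (reg F) P) -(reg_tens_id P k0) /gval.
congr (reg F _ _); apply: functional_extensionality => X.
by rewrite tang_tens_id.
Qed.

Lemma reg_Ap : axiom_Ap (reg F).
Proof.
move=> a1 a2 Phi D h1 h2 hP hD; pose P := CPair h1 h2 hP hD.
apply: (econv_ext (N := 1) (econv_const _)) => n n0; have np := INR_gt0 n0.
rewrite /regseq -[RHS]/(escale _ (gval (reg F) (ppow P n))) reg_pow //.
by rewrite escale_comp Rinv_l ?escale1 //; lra.
Qed.

End Regularization.

(** * Existence of the limits and comparison with a given metric *)

(** The second conjunct is Fekete's bound at n = 1; it supplies the lower half of (N) for the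
    limit. *)
Lemma gmin_lim P : exists l, econv (regseq Gmin (chan P) (tang P)) l /\ ele (gval Gmin P) l.
Proof.
have [||l [h1 h2]] := @fekete_super (fun n => gval Gmin (ppow P n)).
- by move=> n; exact: gmin_ge0.
- move=> m n; apply: ele_trans (gmin_super _ _) _.
  by apply: gmin_mono; exact: ple_powDV.
exists l; split=> //; have := h2 1%N isT; rewrite Rinv_1 escale1.
apply: ele_trans; apply: gmin_mono.
apply: (ple_trans _ (ple_powSV P 0)); apply: ple_trans (ple_swap _ _).
exact: ple_tensr.
Qed.

Lemma gmax_lim P : exists l, econv (regseq Gmax (chan P) (tang P)) l /\ ele l (gval Gmax P).
Proof.
have [|||l [h1 h2]] := @fekete_sub (fun n => gval Gmax (ppow P n)).
- by move=> n; exact: gmax_ge0.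
- move=> m n; apply: gmax_mono.
  by apply: ple_trans (ple_powDV _ _ _); exact: ple_tensr.
- move=> m n; apply: (ele_trans _ (gmax_sub _ _)).
  by apply: gmax_mono; exact: ple_powD.
exists l; split=> //; have := h2 1%N isT; rewrite Rinv_1 escale1 => h.
apply: ele_trans h _; apply: gmax_mono.
apply: ple_trans (ple_powS P 0) _; apply: ple_trans (ple_swap _ _) _.
apply: (ple_trans _ (ple_unit P)); apply: ple_tens; first exact: ple_refl.
exact: ple_pow0.
Qed.

Section Sandwich.
Variable G : cmetric.
Arguments G : clear implicits.
Hypothesis GM : axiom_M G.
Hypothesis GE : axiom_E G.
Hypothesis GN : axiom_N G.

Lemma metric_mono P Q : P <~ Q -> ele (gval G P) (gval G Q).
Proof.
move=> [pre [post [hpre hpost e1 e2]]]; rewrite /gval.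
have -> : chan P = fun X => post (chan Q (pre X)) by apply: functional_extensionality.
have -> : tang P = fun X => post (tang Q (pre X)) by apply: functional_extensionality.
case: GM => M1 M2.
have hQ := chanP Q; have tQ := tangP Q.
apply: (ele_trans (M2 _ _ _ _ _ post _ _ _ _ _ _)) => //; try exact: din_gt0;
  try exact: dout_gt0; first exact: ch_comp hQ hpre.
- exact: tan_pre tQ hpre.
- by apply: M1 => //; try exact: din_gt0; exact: dout_gt0.
Qed.

Lemma metric_tens_id P k (k0 : (0 < k)%N) : gval G (P \ox idpair k0) = gval G P.
Proof.
rewrite /gval -(GE (din_gt0 P) (dout_gt0 P) k0 (chanP P) (tangP P)).
congr (G _ _); apply: functional_extensionality => X.
by rewrite tang_tens_id.
Qed.

Lemma metric_cpair c : gval G (cpair_of c) = cfisher c.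
Proof. by apply: GN; [exact: cprobP | exact: ctangP]. Qed.

(** For [c] below P tensor I, axiom (N) evaluates G at [c], (M) bounds this by the value at P tensor
    I, and (E) removes the ancilla. The upper bound by [Gmax] is the same chain read backwards. *)
Lemma gmin_le_metric P : ele (gval Gmin P) (gval G P).
Proof.
apply: gmin_lub => v [c [k [k0 [/metric_mono h ->]]]].
by move: h; rewrite metric_cpair metric_tens_id.
Qed.

Lemma metric_le_gmax P : ele (gval G P) (gval Gmax P).
Proof.
apply: gmax_glb => v [c [k [k0 [/metric_mono h ->]]]].
by move: h; rewrite metric_tens_id metric_cpair.
Qed.

End Sandwich.

Lemma cfisher_le_gmin c : ele (cfisher c) (gval Gmin (cpair_of c)).
Proof. by apply: gmin_ub; exists c, 1%N, isT; split=> //; exact: ple_tensr. Qed.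

Lemma gmax_le_cfisher c : ele (gval Gmax (cpair_of c)) (cfisher c).
Proof. by apply: gmax_lb; exists c, 1%N, isT; split=> //; exact: ple_tensr. Qed.

Theorem mainTheorem5 (G : cmetric) :
  is_channel_metric G -> axiom_M G -> axiom_E G -> axiom_Ap G -> axiom_N G ->
  (forall a1 a2 (Phi D : Mx a1 -> Mx a2), (0 < a1)%N -> (0 < a2)%N ->
     is_channel Phi -> is_tangent D ->
     [/\ (exists l, econv (regseq Gmin Phi D) l),
         (exists l, econv (regseq Gmax Phi D) l),
         ele (Gminp Phi D) (G _ _ Phi D) &
         ele (G _ _ Phi D) (Gmaxp Phi D)]) /\
  [/\ is_channel_metric Gminp, axiom_M Gminp, axiom_E Gminp,
      axiom_Ap Gminp & axiom_N Gminp] /\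
  [/\ is_channel_metric Gmaxp, axiom_M Gmaxp, axiom_E Gmaxp,
      axiom_Ap Gmaxp & axiom_N Gmaxp].
Proof.
move=> _ GM GE GAp GN.
have min_lim P : exists l, econv (regseq Gmin (chan P) (tang P)) l.
  by have [l [h _]] := gmin_lim P; exists l.
have max_lim P : exists l, econv (regseq Gmax (chan P) (tang P)) l.
  by have [l [h _]] := gmax_lim P; exists l.
have G_lim P : econv (regseq G (chan P) (tang P)) (gval G P).
  exact: GAp (din_gt0 P) (dout_gt0 P) (chanP P) (tangP P).
have min_le P : ele (gval (reg Gmin) P) (gval G P).
  apply: (econv_le (N := 0) (reg_conv min_lim P) (G_lim P)) => n _.
  apply: escale_le (inv_INR_ge0 n) _.
  exact: (gmin_le_metric GM GE GN (ppow P n)).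
have le_max P : ele (gval G P) (gval (reg Gmax) P).
  apply: (econv_le (N := 0) (G_lim P) (reg_conv max_lim P)) => n _.
  apply: escale_le (inv_INR_ge0 n) _.
  exact: (metric_le_gmax GM GE GN (ppow P n)).
split; [|split].
- move=> a1 a2 Phi D h1 h2 hP hD; pose P := CPair h1 h2 hP hD.
  by split; [exact: (min_lim P) | exact: (max_lim P) | exact: (min_le P) | exact: (le_max P)].
- split.
  + exact: reg_channel_metric gmin_ge0 gmin_mono gmin_smul min_lim.
  + exact: reg_M gmin_mono min_lim.
  + exact: reg_E gmin_mono gmin_tens_id min_lim.
  + exact: reg_Ap gmin_mono min_lim.
  + move=> m p d hp hd; pose c := CDist hp hd.
    apply: (@ele_antisym (gval (reg Gmin) (cpair_of c)) (cfisher c)).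
      (* The given metric supplies the data-processing inequality: measurements on powers of a
         classical pair cannot exceed [Jfisher], because G agrees with it there and dominates the
         limit. *)
      by rewrite -(metric_cpair GN); exact: min_le.
    apply: ele_trans (cfisher_le_gmin c) _.
    by have [l [h1 h2]] := gmin_lim (cpair_of c); rewrite /gval /reg (elim_eq h1).
- split.
  + exact: reg_channel_metric gmax_ge0 gmax_mono gmax_smul max_lim.
  + exact: reg_M gmax_mono max_lim.
  + exact: reg_E gmax_mono gmax_tens_id max_lim.
  + exact: reg_Ap gmax_mono max_lim.
  + move=> m p d hp hd; pose c := CDist hp hd.
    apply: (@ele_antisym (gval (reg Gmax) (cpair_of c)) (cfisher c)); last first.
      by rewrite -(metric_cpair GN); exact: le_max.
    apply: (ele_trans _ (gmax_le_cfisher c)).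
    by have [l [h1 h2]] := gmax_lim (cpair_of c); rewrite /gval /reg (elim_eq h1).
Qed.
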